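(* Let $n,n'\ge1$ and $p,q\ge0$ be integers and $W=\mathbb{C}^n\otimes\mathbb{C}^{n'}$. Let $\mathcal{Q}_1$ be the operator algebra in $\operatorname{End}_{\mathbb{C}}(T^{(q)}_p(W))$ generated by $\nu(GL_n(\mathbb{C}))$ and the right multiplication by $S_{p+q}$. Let $\mathcal{Q}_2$ be the set of all linear combinations of the operators on $T^{(q)}_p(W)$ of the form $$\sum_{(i_1,\ldots,i_p)\in\{1,\ldots,n\}^p}L(w_{i_pa_p})\cdots L(w_{i_1a_1})\,L(\sigma)\,L(w^*_{i_1b_1})\cdots L(w^*_{i_pb_p}),$$ where $a_1,\ldots,a_p,b_1,\ldots,b_p\in\{1,\ldots,n'\}$ and $\sigma\in S_{p+q}$. Then $\mathcal{Q}_1$ and $\mathcal{Q}_2$ are mutual commutants of each other in $\operatorname{End}_{\mathbb{C}}(T^{(q)}_p(W))$.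
   Context: Permutations multiply by composition; $S_\infty$ is the inductive limit of $S_0\subset S_1\subset\cdots$. The symbol $\otimes$ is omitted in tensors, and vectors are numbered from right to left. For a finite-dimensional complex vector space $V$, $V^{\otimes p}$ is a right $\mathbb{C}S_p$-module by $v_p\cdots v_1\,\sigma=v_{\sigma(p)}\cdots v_{\sigma(1)}$. Put $T^{(q)}_p(V)=V^{\otimes p}\otimes_{\mathbb{C}S_p}\mathbb{C}S_{p+q}\subset\bar T_p(V)=V^{\otimes p}\otimes_{\mathbb{C}S_p}\mathbb{C}S_\infty$, and $\bar T(V)=\bigoplus_{p\ge0}\bar T_p(V)$, an associative graded algebra with product $$(v_p\cdots v_1\,\sigma)(v'_{p'}\cdots v'_1\,\sigma')=v_p\cdots v_1v'_{p'}\cdots v'_1\,\alpha^{p'}(\sigma)\sigma',$$ where $\alpha$ is the group endomorphism of $S_\infty$ with $\alpha(\sigma)(1)=1$, $\alpha(\sigma)(k)=\sigma(k-1)+1$ for $k\ge2$. $L(\varphi)$ is left multiplication by $\varphi\in\bar T(V)$. For $v^*\in V^*$, $L(v^* )$ is the operator on $\bar T(V)$ with $$L(v^* )\,v_p\cdots v_1\,t=\sum_{k=1}^p\langle v^*,v_k\rangle\,v_p\cdots\hat v_k\cdots v_1\cdot(p\ \,p{-}1\ \cdots\ k{+}1\ \,k)\,t\qquad(t\in\mathbb{C}S_\infty),$$ where $\hat v_k$ means omission and $(p\ p{-}1\cdots k)$ is the cycle $p\mapsto p-1\mapsto\cdots\mapsto k\mapsto p$; $L(v^* )t=0$ for $p=0$.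 For $V=W=\mathbb{C}^n\otimes\mathbb{C}^{n'}$: $w_{ij}$ ($1\le i\le n$, $1\le j\le n'$) is the canonical basis of $W$ and $w^*_{ij}$ the dual basis. $GL_n(\mathbb{C})$ acts on $W$ canonically on the first factor $\mathbb{C}^n$ and trivially on the second; $\nu$ is the induced action on $T^{(q)}_p(W)$, $\nu(g)(v_p\cdots v_1\,\sigma)=(gv_p)\cdots(gv_1)\,\sigma$. The displayed operators map $T^{(q)}_p(W)$ into itself. The commutant of a set of operators is the set of all elements of $\operatorname{End}_{\mathbb C}$ commuting with each of them. *)

(* Defs.v *)
From HB Require Import structures.
From mathcomp Require Import all_boot all_order all_algebra.
From mathcomp Require Import all_classical reals.
From mathcomp Require Import complex.
From mathcomp Require Import freeg.
From mathcomp Require Import zify.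

Set Implicit Arguments.
Unset Strict Implicit.
Unset Printing Implicit Defensive.

Import GRing.Theory.
Local Open Scope ring_scope.
Local Open Scope classical_set_scope.

(* S_oo acts on positions numbered from 0: the 1-based position k is k.-1     *)
(* here.  The product is composition, (s * t) k = s (t k), that is, the       *)
(* opposite of the product of 'S_n.                                           *)

Definition finperm (f : nat -> nat) : bool :=
  `[< bijective f /\ exists N, forall k, (N <= k)%N -> f k = k >].

Record Sinf := MkSinf { sfun :> nat -> nat; _ : finperm sfun }.

HB.instance Definition _ := [isSub for sfun].
HB.instance Definition _ := [Choice of Sinf by <:].

Section SinfGroup.
Implicit Types s t u : Sinf.

Lemma sinfP s t : s =1 t -> s = t.
Proof. by move=> st; apply/val_inj/funext. Qed.

Lemma sinf_bij s : bijective s.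
Proof. by case: s => f /= /asboolP[]. Qed.

Lemma sinf_inj s : injective s.
Proof. exact: bij_inj (sinf_bij s). Qed.

Lemma sinf_fin s : exists N, forall k, (N <= k)%N -> s k = k.
Proof. by case: s => f /= /asboolP[]. Qed.

Fact finperm_id : finperm id.
Proof. by apply/asboolP; split; [exists id | exists 0]. Qed.

Fact finperm_comp s t : finperm (s \o t).
Proof.
apply/asboolP; split; first exact: bij_comp (sinf_bij s) (sinf_bij t).
have [[M HM] [N HN]] := (sinf_fin s, sinf_fin t); exists (maxn M N) => k.
by rewrite geq_max /= => /andP[Mk Nk]; rewrite HN // HM.
Qed.

Fact sinf_inv_ex s : {t : Sinf | cancel s t /\ cancel t s}.
Proof.
apply: cid; have [g sg gs] := sinf_bij s.
suff fg : finperm g by exists (MkSinf fg).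
apply/asboolP; split; first by exists s.
have [N HN] := sinf_fin s; exists N => k Nk.
by rewrite -{1}(HN k Nk) sg.
Qed.

Definition sinf_one := MkSinf finperm_id.
Definition sinf_mul s t := MkSinf (finperm_comp s t).
Definition sinf_inv s := sval (sinf_inv_ex s).

Fact sinf_mulA : associative sinf_mul.
Proof. by move=> s t u; apply: sinfP. Qed.
Fact sinf_mul1 : left_id sinf_one sinf_mul.
Proof. by move=> s; apply: sinfP. Qed.
Fact sinf_1mul : right_id sinf_one sinf_mul.
Proof. by move=> s; apply: sinfP. Qed.
Fact sinf_mulV : left_inverse sinf_one sinf_inv sinf_mul.
Proof.
by move=> s; apply: sinfP => k; rewrite /= /sinf_inv; case: sinf_inv_ex => t [/= + _]; apply.
Qed.
Fact sinf_Vmul : right_inverse sinf_one sinf_inv sinf_mul.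
Proof.
by move=> s; apply: sinfP => k; rewrite /= /sinf_inv; case: sinf_inv_ex => t [/= _]; apply.
Qed.

End SinfGroup.

HB.instance Definition _ :=
  isGroup.Build Sinf sinf_mulA sinf_mul1 sinf_1mul sinf_mulV sinf_Vmul.

Lemma sinfM (s t : Sinf) k : (s * t)%g k = s (t k). Proof. by []. Qed.
Lemma sinf1 k : (1%g : Sinf) k = k. Proof. by []. Qed.
Lemma sinfKV (s : Sinf) : cancel s (s^-1)%g.
Proof. by move=> k; rewrite -sinfM mulVg. Qed.
Lemma sinfVK (s : Sinf) : cancel (s^-1)%g s.
Proof. by move=> k; rewrite -sinfM mulgV. Qed.

Definition inS (N : nat) (s : Sinf) : Prop := forall k, (N <= k)%N -> s k = k.

Fact finperm_alpha (s : Sinf) :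
  finperm (fun k => if k is k'.+1 then (s k').+1 else 0%N).
Proof.
apply/asboolP; split.
  exists (fun k => if k is k'.+1 then ((s^-1)%g k').+1 else 0%N).
    by case=> // k; rewrite sinfKV.
  by case=> // k; rewrite sinfVK.
by have [N HN] := sinf_fin s; exists N.+1 => -[//|k] Nk; rewrite HN.
Qed.

Definition alpha (s : Sinf) : Sinf := MkSinf (finperm_alpha s).

(* In 1-based positions, cyc p k is the cycle (p p-1 ... k+1), that is,        *)
(* p |-> p-1 |-> ... |-> k+1 |-> p; it is the identity for k >= p.             *)
Fact finperm_cyc p k :
  finperm (fun j => if (k <= j < p)%N then if j == k then p.-1 else j.-1 else j).
Proof.
apply/asboolP; split; last first.
  by exists p => j pj; rewrite [(j < p)%N]ltnNge pj andbF.
exists (fun j => if (k <= j < p)%N then if j == p.-1 then k else j.+1 else j).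
  move=> j; case: (boolP (k <= j < p)%N) => [kjp|/negPf->//].
  case: (eqVneq j k) => [jk|jk].
    have -> : (k <= p.-1 < p)%N by lia.
    by rewrite eqxx jk.
  have -> : (k <= j.-1 < p)%N by lia.
  have /negPf-> : j.-1 != p.-1 by lia.
  by lia.
move=> j; case: (boolP (k <= j < p)%N) => [kjp|/negPf->//].
case: (eqVneq j p.-1) => [jk|jk].
  have -> : (k <= k < p)%N by lia.
  by rewrite eqxx jk.
have -> : (k <= j.+1 < p)%N by lia.
have /negPf-> : j.+1 != k by lia.
by [].
Qed.

Definition cyc p k : Sinf := MkSinf (finperm_cyc p k).

Lemma inS_cyc p k : inS p (cyc p k).
Proof. by move=> j pj; rewrite /= [(j < p)%N]ltnNge pj andbF. Qed.

Lemma inS_le m n t : (m <= n)%N -> inS m t -> inS n t.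
Proof. by move=> mn mt k nk; apply: mt; apply: leq_trans nk. Qed.

Lemma inSM n s t : inS n s -> inS n t -> inS n (s * t)%g.
Proof. by move=> sn tn k nk; rewrite sinfM tn // sn. Qed.

Lemma inSV n s : inS n s -> inS n (s^-1)%g.
Proof. by move=> sn k nk; rewrite -{1}(sn k nk) sinfKV. Qed.

Lemma inS_ltn n s k : inS n s -> (k < n)%N -> (s k < n)%N.
Proof.
move=> sn kn; rewrite ltnNge; apply/negP => nk.
by have /sinf_inj skk := sn _ nk; move: nk; rewrite skk leqNgt kn.
Qed.

Lemma iter_alphaE n s k :
  iter n alpha s k = if (k < n)%N then k else (s (k - n) + n)%N.
Proof.
elim: n k => [|n IHn] k; first by rewrite /= subn0 addn0.
by case: k => [//|k] /=; rewrite IHn ltnS subSS addnS; case: ltnP.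
Qed.

Lemma alphaM s t : alpha (s * t)%g = (alpha s * alpha t)%g.
Proof. by apply: sinfP => -[]. Qed.

Lemma iter_alphaM n s t : iter n alpha (s * t)%g = (iter n alpha s * iter n alpha t)%g.
Proof. by elim: n => //= n ->; rewrite alphaM. Qed.

Lemma inS_alpha m n s : inS m s -> inS (n + m) (iter n alpha s).
Proof.
move=> sm k nmk; rewrite iter_alphaE ltnNge (leq_trans (leq_addr m n) nmk) /=.
by rewrite sm ?leq_subRL ?subnK //; lia.
Qed.

Lemma alpha_commute n s t :
  inS n s -> (s * iter n alpha t = iter n alpha t * s)%g.
Proof.
move=> sn; apply: sinfP => k; rewrite !sinfM !iter_alphaE.
case: (ltnP k n) => [kn|nk]; first by rewrite inS_ltn.
rewrite (sn k nk) [in RHS]ltnNge nk /=.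
by rewrite sn // leq_addl.
Qed.

Section Span.
Variables (K : fieldType) (M : lmodType K).

Definition lspan (A : set M) : set M :=
  [set x | exists (m : nat) (c : 'I_m -> K) (u : 'I_m -> M),
     (forall i, A (u i)) /\ x = \sum_(i < m) c i *: u i].

Lemma lspan0 A : lspan A 0.
Proof.
by exists 0%N, (fun=> 0), (fun=> 0); rewrite big_ord0; split=> // -[].
Qed.

Lemma lspanZD A a x y : lspan A x -> lspan A y -> lspan A (a *: x + y).
Proof.
move=> [m [c [u [Au ->]]]] [n [d [v [Av ->]]]].
exists (m + n)%N.
exists (fun i : 'I_(m + n) => match fintype.split i with inl j => a * c j | inr j => d j end).
exists (fun i : 'I_(m + n) => match fintype.split i with inl j => u j | inr j => v j end).
split; first by move=> i; case: fintype.split.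
rewrite big_split_ord scaler_sumr /=; congr (_ + _); apply: eq_bigr => i _.
  by rewrite (unsplitK (inl i)) scalerA.
by rewrite (unsplitK (inr i)).
Qed.

Lemma lspan_gen A x : A x -> lspan A x.
Proof.
by move=> Ax; exists 1%N, (fun=> 1), (fun=> x); rewrite big_ord1 scale1r.
Qed.

Fact lspan_submod A : submod_closed (fun x : M => `[< lspan A x >] : bool).
Proof.
split; first exact/asboolP/lspan0.
by move=> a x y /asboolP Ax /asboolP Ay; apply/asboolP/lspanZD.
Qed.

End Span.

Lemma lspan_homo (K : fieldType) (M N : lmodType K) (f : {linear M -> N}) (A : set M) (B : set N) :
  (forall x, A x -> lspan B (f x)) -> forall x, lspan A x -> lspan B (f x).
Proof.
move=> AB _ [m [c [u [Au ->]]]]; rewrite linear_sum /=.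
elim/big_rec: _ => [|i y _ By]; first exact: lspan0.
by rewrite linearZ; apply: lspanZD => //; apply: AB.
Qed.

(* A tensor v_p ... v_1 is encoded by the sequence [:: v_1; ...; v_p], so     *)
(* that v_(k+1) is nth 0 s k; concatenating v_p ... v_1 v'_p' ... v'_1 is     *)
(* then s' ++ s.                                                              *)

Section Tbar.
Variables (K : fieldType) (V : lmodType K).

Definition wact (s : seq V) (t : Sinf) : seq V :=
  mkseq (fun k => nth 0 s (t k)) (size s).

Notation tfree := {freeg (seq V * Sinf)%type / K}.
Definition tgen (s : seq V) (t : Sinf) : tfree := Freeg [:: (1, (s, t))].

(* Tbar is the module generated by the symbols v_p ... v_1 s, for all p and   *)
(* all s in S_oo, modulo multilinearity and (v t) s = v (t s) for t in S_p:   *)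
(* the usual presentation of the direct sum over p of the tensor products     *)
(* over K[S_p] of the p-th tensor power of V and K[S_oo].                     *)
Inductive trel : set tfree :=
| TrelLin s1 s2 a u v t :
    trel (tgen (s1 ++ (a *: u + v) :: s2) t
          - (a *: tgen (s1 ++ u :: s2) t + tgen (s1 ++ v :: s2) t))
| TrelBal s t t' : inS (size s) t ->
    trel (tgen (wact s t) t' - tgen s (t * t')%g).

Definition tker : {pred tfree} := fun x => `[< lspan trel x >].
HB.instance Definition _ :=
  GRing.isSubmodClosed.Build K tfree tker (lspan_submod trel).

Definition Tbar : Type := {ideal_quot tker}.
HB.instance Definition _ := GRing.Zmodule.on Tbar.

Definition tpi (x : tfree) : Tbar := \pi_({ideal_quot tker})%qT x.

Lemma tpiP x y : tpi x = tpi y <-> lspan trel (x - y).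
Proof.
rewrite /tpi; split=> [/eqP|xy].
  by rewrite -Quotient.idealrBE => /asboolP.
by apply/eqP; rewrite -Quotient.idealrBE; apply/asboolP.
Qed.

Lemma tpiK x : tpi (repr x) = x. Proof. exact: reprK. Qed.

Definition tscale a (x : Tbar) : Tbar := tpi (a *: repr x).

Lemma tscaleE a x : tscale a (tpi x) = tpi (a *: x).
Proof.
apply/tpiP; rewrite -scalerBr -[_ *: _]addr0.
by apply: lspanZD; [apply/tpiP; rewrite tpiK | apply: lspan0].
Qed.

Lemma tpiD x y : tpi (x + y) = tpi x + tpi y.
Proof. exact: (raddfD (\pi_({ideal_quot tker})%qT : {additive _ -> _})). Qed.

Fact tscaleA a b x : tscale a (tscale b x) = tscale (a * b) x.
Proof. by rewrite -[x]tpiK !tscaleE scalerA. Qed.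
Fact tscale1 : left_id 1 tscale.
Proof. by move=> x; rewrite -[x]tpiK !tscaleE scale1r. Qed.
Fact tscaleDr : right_distributive tscale +%R.
Proof.
by move=> a x y; rewrite -[x]tpiK -[y]tpiK -tpiD !tscaleE scalerDr tpiD.
Qed.
Fact tscaleDl x : {morph tscale^~ x : a b / a + b}.
Proof. by move=> a b; rewrite -[x]tpiK !tscaleE scalerDl tpiD. Qed.
HB.instance Definition _ :=
  GRing.Zmodule_isLmodule.Build K Tbar tscaleA tscale1 tscaleDr tscaleDl.

Fact tpi_linear : linear tpi.
Proof. by move=> a x y; rewrite tpiD -tscaleE. Qed.
HB.instance Definition _ := GRing.isLinear.Build K tfree Tbar _ tpi tpi_linear.

Definition mono (s : seq V) (t : Sinf) : Tbar := tpi (tgen s t).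

Lemma mono_lin s1 s2 a u v t :
  mono (s1 ++ (a *: u + v) :: s2) t
  = a *: mono (s1 ++ u :: s2) t + mono (s1 ++ v :: s2) t.
Proof.
by rewrite /mono -linearP; apply/tpiP/lspan_gen/TrelLin.
Qed.

Lemma mono_bal s t t' : inS (size s) t -> mono (wact s t) t' = mono s (t * t')%g.
Proof. by move=> st; apply/tpiP/lspan_gen/TrelBal. Qed.

Lemma Tbar_span x : lspan [set y | exists s t, y = mono s t] x.
Proof.
rewrite -[x]tpiK -[repr x]freeg_sumE linear_sum /=.
elim/big_rec: _ => [|[s t] y _ By]; first exact: lspan0.
have -> : << coeff (s, t) (repr x) *g (s, t) >>
          = coeff (s, t) (repr x) *: tgen s t.
  by apply/eqP/freeg_eqP => z; rewrite coeffZ !coeffU mul1r.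
by rewrite linearZ; apply: lspanZD => //; apply: lspan_gen; exists s, t.
Qed.

Lemma Tbar_ext (M : lmodType K) (f g : {linear Tbar -> M}) :
  (forall s t, f (mono s t) = g (mono s t)) -> f =1 g.
Proof.
move=> fg x; have [m [c [u [uE ->]]]] := Tbar_span x.
rewrite !linear_sum; apply: eq_bigr => i _; rewrite !linearZ.
by have [s [t ->]] := uE i; rewrite fg.
Qed.

Section Lift.
Variables (M : lmodType K) (h : seq V * Sinf -> M).

Definition compat : Prop :=
  (forall s1 s2 a u v t, h (s1 ++ (a *: u + v) :: s2, t)
     = a *: h (s1 ++ u :: s2, t) + h (s1 ++ v :: s2, t)) /\
  (forall s t t', inS (size s) t -> h (wact s t, t') = h (s, (t * t')%g)).

(* The linear extension of h; meaningful when h satisfies compat. *)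
Definition tlift (x : Tbar) : M := fglift h (repr x).

Fact fglift_linear : linear (fglift h).
Proof.
have fB : {morph fglift h : x y / x - y} := lift_is_additive h.
have f0 : fglift h 0 = 0 by rewrite -[0](subrr 0) fB subrr.
have fD : {morph fglift h : x y / x + y}.
  move=> x y; have -> : x + y = x - (0 - y) by rewrite sub0r opprK.
  by rewrite !fB f0 sub0r opprK.
move=> a x y; rewrite fD; congr (_ + _).
rewrite -{2}[x]freeg_sumE [_ *: _]/(fgscale a x) /fgscale.
rewrite !(big_morph _ fD f0) scaler_sumr.
by apply: eq_bigr => i _; rewrite !liftU scalerA.
Qed.
HB.instance Definition _ :=
  GRing.isLinear.Build K tfree M _ (fglift h) fglift_linear.

Hypothesis hP : compat.

Lemma fglift_ker x : lspan trel x -> fglift h x = 0.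
Proof.
have [hl hb] := hP; have hg s t : fglift h (tgen s t) = h (s, t).
  by rewrite liftU scale1r.
move=> [m [c [u [uE ->]]]]; rewrite linear_sum big1 // => i _.
rewrite linearZ; case: (uE i) => [s1 s2 a v w t|s t t' st] /=.
  by rewrite lift_is_additive fglift_linear !hg hl subrr scaler0.
by rewrite lift_is_additive !hg hb // subrr scaler0.
Qed.

Lemma tlift_pi x : tlift (tpi x) = fglift h x.
Proof.
apply/eqP; rewrite -subr_eq0 /tlift -linearB; apply/eqP/fglift_ker/tpiP.
by rewrite tpiK.
Qed.

Lemma tlift_mono s t : tlift (mono s t) = h (s, t).
Proof. by rewrite tlift_pi liftU scale1r. Qed.

Lemma tlift_linear : linear tlift.
Proof.
by move=> a x y; rewrite -[x]tpiK -[y]tpiK -linearP !tlift_pi linearP.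
Qed.

End Lift.

Definition tmul0 (s : seq V) (t : Sinf) (x : seq V * Sinf) : Tbar :=
  mono (x.1 ++ s) (iter (size x.1) alpha t * x.2)%g.

Lemma size_wact s t : size (wact s t) = size s.
Proof. exact: size_mkseq. Qed.

Lemma nth_wact s t k : (k < size s)%N -> nth 0 (wact s t) k = nth 0 s (t k).
Proof. exact: nth_mkseq. Qed.

Lemma wact_catl s s' t : inS (size s) t -> wact s t ++ s' = wact (s ++ s') t.
Proof.
move=> st; apply: (@eq_from_nth _ 0); rewrite ?size_cat !size_wact ?size_cat //.
move=> k ks; rewrite nth_cat size_wact [RHS]nth_wact ?size_cat // nth_cat.
case: (ltnP k (size s)) => kn; first by rewrite inS_ltn // nth_wact.
by rewrite st // ltnNge kn.
Qed.

Lemma wact_catr s s' t : inS (size s') t ->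
  s ++ wact s' t = wact (s ++ s') (iter (size s) alpha t).
Proof.
move=> st; apply: (@eq_from_nth _ 0); rewrite ?size_cat !size_wact ?size_cat //.
move=> k ks; rewrite nth_cat [RHS]nth_wact ?size_cat // nth_cat iter_alphaE.
case: (ltnP k (size s)) => kn; first by rewrite kn.
by rewrite nth_wact ?ltn_subLR // ltnNge leq_addl /= addnK.
Qed.

Lemma tmul0_compat s t : compat (tmul0 s t).
Proof.
split=> [s1 s2 a u v t1|s1 t1 t2 st] /=; rewrite /tmul0 /=.
  by rewrite -!catA /= !size_cat /= mono_lin.
rewrite wact_catl // size_wact mono_bal; last first.
  by apply: inS_le st; rewrite size_cat leq_addr.
by rewrite !mulgA alpha_commute.
Qed.

Definition tmul1 (y : Tbar) (x : seq V * Sinf) : Tbar := tlift (tmul0 x.1 x.2) y.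

Lemma tmul1_mono s' t' s t :
  tmul1 (mono s' t') (s, t) = mono (s' ++ s) (iter (size s') alpha t * t')%g.
Proof. by rewrite /tmul1 tlift_mono //; apply: tmul0_compat. Qed.

Lemma tmul1_linear x : linear (tmul1^~ x).
Proof. by move=> a y z; rewrite /tmul1 (tlift_linear (tmul0_compat _ _)). Qed.

Lemma Tbar_ind (P : Tbar -> Prop) :
  P 0 -> (forall a s t x, P x -> P (a *: mono s t + x)) -> forall x, P x.
Proof.
move=> P0 PD x; have [m [c [u [uE ->]]]] := Tbar_span x.
by elim/big_rec: _ => // i y _ Py; have [s [t ->]] := uE i; apply: PD.
Qed.

Lemma tmul1_compat y : compat (tmul1 y).
Proof.
have l0 x : tmul1 0 x = 0.
  have := tmul1_linear x (- 1) 0 0.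
  by rewrite scaler0 addr0 scaleN1r addNr.
split=> [s1 s2 a u v t|s t1 t2 st] /=.
  elim/Tbar_ind: y => [|b s t' y IHy].
    by rewrite !l0 scaler0 addr0.
  rewrite !tmul1_linear IHy !tmul1_mono !catA mono_lin !scalerDr !scalerA.
  by rewrite mulrC addrACA.
elim/Tbar_ind: y => [|b s' t' y IHy]; first by rewrite !l0.
rewrite !tmul1_linear IHy !tmul1_mono wact_catr // mono_bal.
  by rewrite iter_alphaM mulgA.
by rewrite size_cat; apply: inS_alpha.
Qed.

Definition tmul (x y : Tbar) : Tbar := tlift (tmul1 y) x.

Lemma tmul_mono s t s' t' :
  tmul (mono s t) (mono s' t') = mono (s' ++ s) (iter (size s') alpha t * t')%g.
Proof. by rewrite /tmul tlift_mono ?tmul1_mono //; apply: tmul1_compat. Qed.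

Lemma tmul_linearl y : linear (tmul^~ y).
Proof. exact: tlift_linear (tmul1_compat y). Qed.

Lemma tmul_linearr x : linear (tmul x).
Proof.
move=> a y z; elim/Tbar_ind: x => [|b s t x IHx].
  have l0 w : tmul 0 w = 0.
    have := tmul_linearl w (- 1) 0 0.
    by rewrite scaler0 addr0 scaleN1r addNr.
  by rewrite !l0 scaler0 addr0.
rewrite !tmul_linearl IHx /tmul !tlift_mono; try exact: tmul1_compat.
rewrite tmul1_linear !scalerDr !scalerA mulrC -!addrA; congr (_ + _).
by rewrite addrCA.
Qed.

HB.instance Definition _ x :=
  GRing.isLinear.Build K Tbar Tbar _ (tmul x) (tmul_linearr x).

Lemma tmulA : associative tmul.
Proof.
have l0 w : tmul 0 w = 0.
  have := tmul_linearl w (- 1) 0 0.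
  by rewrite scaler0 addr0 scaleN1r addNr.
move=> x y z; elim/Tbar_ind: x => [|a s t x IHx]; first by rewrite !l0.
rewrite !tmul_linearl -IHx; congr (_ *: _ + _) => {IHx x}.
elim/Tbar_ind: y => [|b s1 t1 y IHy]; first by rewrite !(l0, linear0).
rewrite tmul_linearr !tmul_linearl tmul_linearr -IHy; congr (_ *: _ + _) => {IHy y}.
elim/Tbar_ind: z => [|c s2 t2 z IHz]; first by rewrite !linear0.
rewrite !tmul_linearr -IHz; congr (_ *: _ + _).
rewrite !tmul_mono catA size_cat iter_alphaM -iterD mulgA.
by rewrite addnC.
Qed.

Definition tvec (v : V) : Tbar := mono [:: v] 1%g.
Definition tsig (t : Sinf) : Tbar := mono [::] t.

Definition Lmul (x : Tbar) : Tbar -> Tbar := tmul x.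
Definition Rperm (t : Sinf) : Tbar -> Tbar := tmul^~ (tsig t).

HB.instance Definition _ x := GRing.Linear.on (Lmul x).
HB.instance Definition _ t :=
  GRing.isLinear.Build K Tbar Tbar _ (Rperm t) (tmul_linearl (tsig t)).

Lemma Lmul_vec v s t : Lmul (tvec v) (mono s t) = mono (rcons s v) t.
Proof.
rewrite /Lmul tmul_mono cats1; congr mono; apply: sinfP => k.
by rewrite sinfM iter_alphaE /=; case: ltnP => // /subnK.
Qed.

Lemma Lmul_perm t' s t :
  Lmul (tsig t') (mono s t) = mono s (iter (size s) alpha t' * t)%g.
Proof. by rewrite /Lmul tmul_mono cats0. Qed.

Lemma Rperm_mono t' s t : Rperm t' (mono s t) = mono s (t * t')%g.
Proof. by rewrite /Rperm tmul_mono. Qed.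

Definition del k (s : seq V) := take k s ++ drop k.+1 s.

(* nth 0 s k is v_(k+1), whence the cycle (p p-1 ... k+1).                    *)
Definition Ldual0 (f : {linear V -> K^o}) (x : seq V * Sinf) : Tbar :=
  \sum_(k < size x.1)
     (f (nth 0 x.1 k) : K) *: mono (del k x.1) (cyc (size x.1) k * x.2)%g.

Definition Ldual (f : {linear V -> K^o}) : Tbar -> Tbar := tlift (Ldual0 f).

Lemma size_del k s : (k < size s)%N -> size (del k s) = (size s).-1.
Proof. by move=> ks; rewrite size_cat size_take size_drop ks; lia. Qed.

Lemma nth_del s k m : (k < size s)%N -> (m < size s)%N -> m != k ->
  nth 0 (del k s) (cyc (size s) k m) = nth 0 s m.
Proof.
move=> ks ms mk; rewrite /= ms andbT (negPf mk) nth_cat size_take ks.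
case: (leqP k m) => km.
  have -> : (m.-1 < k)%N = false by lia.
  by rewrite nth_drop; congr nth; lia.
by rewrite km nth_take.
Qed.

Lemma Ldual0_compat f : compat (Ldual0 f).
Proof.
split=> [s1 s2 a u v t|s t1 t2 st]; rewrite /Ldual0 /=.
  rewrite !size_cat /= scaler_sumr -big_split /=; apply: eq_bigr => k _.
  rewrite !nth_cat; case: (ltngtP k (size s1)) => [ks|sk|ksE].
  - have delE x : del k (s1 ++ x :: s2) = del k s1 ++ x :: s2.
      rewrite /del take_cat drop_cat ks -catA; congr (_ ++ _).
      case: ltnP => // s1k; have -> : k.+1 = size s1 by apply/eqP; rewrite eqn_leq s1k andbT; exact: ks.
      by rewrite subnn drop0 drop_size.
    rewrite !delE mono_lin scalerDr !scalerA mulrC //.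
  - have [j kE] : exists j, (k : nat) = (size s1 + j.+1)%N.
      by exists (k - size s1).-1; lia.
    have delE x : del k (s1 ++ x :: s2) = s1 ++ x :: del j s2.
      rewrite /del kE -addnS takeD take_size_cat // drop_size_cat //= -catA.
      by congr (_ ++ _); rewrite addnC -drop_drop drop_size_cat.
    by rewrite !delE kE addKn /= mono_lin scalerDr !scalerA mulrC.
  have delE x : del k (s1 ++ x :: s2) = s1 ++ s2.
    rewrite /del ksE take_size_cat // drop_cat ltnNge leqnSn /=.
    by rewrite subSnn /= drop0.
  by rewrite !delE ksE subnn /= linearP scalerDl scalerA.
rewrite size_wact; set p := size s in st *.
have tlt (k : 'I_p) : (t1 k < p)%N by apply: inS_ltn.
have bij_t : {on [pred _ | true], bijective (fun k => Ordinal (tlt k) : 'I_p)}.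
  apply: onW_bij; apply: injF_bij => j k [] /sinf_inj; exact: val_inj.
rewrite [RHS](reindex _ bij_t) /=; apply: eq_bigr => k _.
rewrite nth_wact //; congr (_ *: _).
have kp : (k < p)%N by [].
pose r := (cyc p (t1 k) * t1 * (cyc p k)^-1)%g.
have p0 : (0 < p)%N by apply: leq_ltn_trans kp.
have cyck j : (j < p)%N -> cyc p j j = p.-1 by move=> jp; rewrite /= leqnn jp eqxx.
have rS : inS p.-1 r.
  move=> j; rewrite leq_eqVlt => /orP[/eqP<-|pj].
    by rewrite /r !sinfM -{1}(cyck k kp) sinfKV cyck.
  have pj' : (p <= j)%N by lia.
  have := inSM (inSM (@inS_cyc p (t1 k)) st) (inSV (@inS_cyc p k)).
  by rewrite -/r; apply.
have -> : del k (wact s t1) = wact (del (t1 k) s) r.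
  apply: (@eq_from_nth _ 0).
    by rewrite size_wact !size_del ?size_wact.
  rewrite size_del size_wact // => i ip; rewrite nth_wact ?size_del //.
  rewrite /r !sinfM -[i in LHS](sinfVK (cyc p k)).
  set m := (cyc p k)^-1%g i.
  have mp : (m < p)%N.
    by apply: inS_ltn; [apply: inSV; apply: inS_cyc | lia].
  have mk : m != k.
    apply/eqP => mk; have := sinfVK (cyc p k) i; rewrite -/m mk cyck //; lia.
  have := @nth_del (wact s t1) k m; rewrite size_wact nth_wact // => -> //.
  rewrite nth_del //; first exact: inS_ltn.
  by rewrite (inj_eq (@sinf_inj t1)).
rewrite mono_bal ?size_del // /r -!mulgA; congr mono.
by rewrite (mulgA (cyc p k)^-1%g) mulVg mul1g.
Qed.

Fact Ldual_linear f : linear (Ldual f).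
Proof. exact: tlift_linear (Ldual0_compat f). Qed.
HB.instance Definition _ f :=
  GRing.isLinear.Build K Tbar Tbar _ (Ldual f) (Ldual_linear f).

Lemma Ldual_mono f s t :
  Ldual f (mono s t)
  = \sum_(k < size s)
      (f (nth 0 s k) : K) *: mono (del k s) (cyc (size s) k * t)%g.
Proof. by rewrite /Ldual tlift_mono //; apply: Ldual0_compat. Qed.

Definition Tmap0 (g : {linear V -> V}) (x : seq V * Sinf) : Tbar :=
  mono (map g x.1) x.2.
Definition Tmap (g : {linear V -> V}) : Tbar -> Tbar := tlift (Tmap0 g).

Lemma Tmap0_compat g : compat (Tmap0 g).
Proof.
split=> [s1 s2 a u v t|s t t' st]; rewrite /Tmap0 /=.
  by rewrite !map_cat /= linearP mono_lin.
rewrite -mono_bal ?size_map //; congr mono.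
apply: (@eq_from_nth _ 0); first by rewrite size_map !size_wact size_map.
rewrite size_map size_wact => k ks.
rewrite (nth_map 0) ?size_wact // !nth_wact ?size_map //.
by rewrite (nth_map 0) // inS_ltn.
Qed.

Fact Tmap_linear g : linear (Tmap g).
Proof. exact: tlift_linear (Tmap0_compat g). Qed.
HB.instance Definition _ g :=
  GRing.isLinear.Build K Tbar Tbar _ (Tmap g) (Tmap_linear g).

Lemma Tmap_mono g s t : Tmap g (mono s t) = mono (map g s) t.
Proof. by rewrite /Tmap tlift_mono //; apply: Tmap0_compat. Qed.

End Tbar.

Arguments tvec {K V} v.
Arguments tsig {K V} t.
Arguments Rperm {K V} t _.

Section Tpq.
Variables (K : fieldType) (V : lmodType K).

Definition tgens p N : set (Tbar V) :=
  [set x | exists s t, [/\ size s = p, inS N t & x = mono s t]].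

(* T_p^(q)(V), as the subspace of Tbar spanned by the v_p ... v_1 t with t in *)
(* S_(p+q).                                                                   *)
Definition tpq p q : {pred Tbar V} := fun x => `[< lspan (tgens p (p + q)) x >].
HB.instance Definition _ p q :=
  GRing.isSubmodClosed.Build K (Tbar V) (tpq p q) (lspan_submod _).

Record Tpq p q := MkTpq { tval :> Tbar V; _ : tval \in tpq p q }.
HB.instance Definition _ p q := [isSub for @tval p q].
HB.instance Definition _ p q := [Choice of Tpq p q by <:].
HB.instance Definition _ p q := [SubChoice_isSubLmodule of Tpq p q by <:].

(* The operator induced on T_p^(q) by an operator of Tbar that preserves it.  *)
Definition restr p q (f : Tbar V -> Tbar V) (x : Tpq p q) : Tpq p q :=
  insubd 0 (f (val x)).

Lemma restrE p q f (x : Tpq p q) : {homo f : y / y \in tpq p q} ->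
  val (restr f x) = f (val x).
Proof. by move=> fT; rewrite val_insubd fT //; apply: valP. Qed.

Lemma restr_linear p q (f : {linear Tbar V -> Tbar V}) :
  {homo f : y / y \in tpq p q} -> linear (@restr p q f).
Proof.
by move=> fT a x y; apply: val_inj; rewrite restrE // !linearP /= !restrE.
Qed.

Lemma tpq_homo p q p' q' (f : {linear Tbar V -> Tbar V}) :
  (forall s t, size s = p -> inS (p + q) t -> f (mono s t) \in tpq p' q') ->
  forall x, x \in tpq p q -> f x \in tpq p' q'.
Proof.
move=> fT x /asboolP Tx; apply/asboolP; apply: lspan_homo Tx.
by move=> y [s [t [sp tN ->]]]; have /asboolP := fT s t sp tN.
Qed.

Lemma mono_tpq p q s t : size s = p -> inS (p + q) t -> mono s t \in tpq p q.
Proof. by move=> sp tN; apply/asboolP/lspan_gen; exists s, t. Qed.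

Lemma Tmap_tpq p q g : {homo @Tmap K V g : x / x \in tpq p q}.
Proof.
apply: tpq_homo => s t sp tN; rewrite /= Tmap_mono.
by apply: mono_tpq; rewrite ?size_map.
Qed.

Lemma Rperm_tpq p q t : inS (p + q) t -> {homo @Rperm K V t : x / x \in tpq p q}.
Proof.
move=> tN; apply: tpq_homo => s t' sp t'N; rewrite /= Rperm_mono.
by apply: mono_tpq => //; apply: inSM.
Qed.

Lemma Lmul_perm_tpq q t x : inS q t -> x \in tpq 0 q -> Lmul (tsig t) x \in tpq 0 q.
Proof.
move=> tN; apply: tpq_homo => s t' s0 t'N; rewrite /= Lmul_perm s0.
by apply: mono_tpq => //; apply: inSM.
Qed.

Lemma Lmul_vec_tpq p q v x : x \in tpq p q.+1 -> Lmul (tvec v) x \in tpq p.+1 q.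
Proof.
apply: tpq_homo => s t sp tN; rewrite /= Lmul_vec.
by apply: mono_tpq; [rewrite size_rcons sp | rewrite addSnnS].
Qed.

Lemma Ldual_tpq p q f x : x \in tpq p.+1 q -> @Ldual K V f x \in tpq p q.+1.
Proof.
apply: tpq_homo => s t sp tN; rewrite /= Ldual_mono.
apply: rpred_sum => k _; apply/rpredZ/mono_tpq; first by rewrite size_del // sp.
by rewrite -addSnnS; apply: inSM tN; apply: inS_le (@inS_cyc _ _); rewrite sp leq_addr.
Qed.

End Tpq.

Section Operators.
Variables (K : fieldType) (M : lmodType K).

Definition commutant (A : set (M -> M)) : set (M -> M) :=
  [set f | linear f /\ forall g, A g -> f \o g = g \o f].

Definition op_subalgebra (A : set (M -> M)) : Prop :=
  [/\ A idfun, forall (a : K) f g, A f -> A g -> A (a *: f + g)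
    & forall f g, A f -> A g -> A (f \o g)].

Definition op_algebra (G : set (M -> M)) : set (M -> M) :=
  smallest op_subalgebra G.

End Operators.

Section Q.
Variables (K : fieldType) (n n' p q : nat).

(* K^n (x) K^n', with w_ij = delta_mx i j.                                    *)
Notation W := 'M[K]_(n, n').

Definition wvec (i : 'I_n) (j : 'I_n') : W := delta_mx i j.

Definition wdual (i : 'I_n) (j : 'I_n') : W -> K^o := fun x => x i j.

Fact wdual_linear i j : linear (wdual i j).
Proof. by move=> a x y; rewrite /wdual !mxE. Qed.
HB.instance Definition _ i j :=
  GRing.isLinear.Build K W K^o _ (wdual i j) (wdual_linear i j).

Lemma wdualE i j i' j' : wdual i j (wvec i' j') = ((i == i') && (j == j'))%:R.
Proof. exact: mxE. Qed.

Definition nu (g : 'M[K]_n) : Tbar W -> Tbar W := Tmap (mulmx g).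

Lemma nuE g (s : seq W) t : nu g (mono s t) = mono [seq g *m v | v <- s] t.
Proof. exact: Tmap_mono. Qed.

Lemma mulmx_wvec g i j : g *m wvec i j = \sum_i' g i' i *: wvec i' j.
Proof.
apply/matrixP => k l; rewrite summxE mxE (bigD1 i) //= !mxE eqxx /=.
rewrite big1 ?addr0 => [|r ri]; last by rewrite mxE (negPf ri) mulr0.
rewrite (bigD1 k) //= big1 ?addr0 => [|r rk].
  by rewrite !mxE eqxx.
by rewrite !mxE eq_sym (negPf rk) mulr0.
Qed.

Definition Q1 : set (Tpq W p q -> Tpq W p q) :=
  op_algebra ([set @restr _ _ p q (nu g) | g in [set g | g \in unitmx]]
              `|` [set @restr _ _ p q (Rperm t) | t in [set t | inS (p + q) t]]).

(* 'I_p is 0-based: i k stands for i_(k+1), so the first product is           *)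
(* L(w_(i_p a_p)) o ... o L(w_(i_1 a_1)), the second one                      *)
(* L(w*_(i_1 b_1)) o ... o L(w*_(i_p b_p)).                                   *)
Definition Lw (i : 'I_p -> 'I_n) (a : 'I_p -> 'I_n') : Tbar W -> Tbar W :=
  \big[(fun f g => f \o g)/idfun]_(k < p)
     Lmul (tvec (wvec (i (rev_ord k)) (a (rev_ord k)))).

Definition Lwdual (i : 'I_p -> 'I_n) (b : 'I_p -> 'I_n') : Tbar W -> Tbar W :=
  \big[(fun f g => f \o g)/idfun]_(k < p) Ldual (wdual (i k) (b k)).

Definition Lop (a b : 'I_p -> 'I_n') (t : Sinf) : Tbar W -> Tbar W :=
  fun x => \sum_(i : {ffun 'I_p -> 'I_n})
     (Lw i a \o Lmul (tsig t) \o Lwdual i b) x.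

Definition Q2 : set (Tpq W p q -> Tpq W p q) :=
  lspan [set f | exists a b t, inS (p + q) t /\ f = restr (Lop a b t)].

Lemma Lop_tpq a b t : inS (p + q) t -> {homo Lop a b t : x / x \in tpq p q}.
Proof.
move=> tN x Tx; apply: rpred_sum => i _ /=.
have down m (F : 'I_m -> Tbar W -> Tbar W) r s :
    (forall k c d y, y \in tpq c.+1 d -> F k y \in tpq c d.+1) ->
  forall y, y \in tpq (m + r) s ->
  (\big[(fun f g => f \o g)/idfun]_(k < m) F k) y \in tpq r (m + s).
  elim: m F r => [|m IHm] F r Fd y Ty; first by rewrite big_ord0.
  rewrite big_ord_recl /=; apply: (Fd); apply: IHm => [k|]; first exact: Fd.
  by rewrite -addSnnS.
have up m (F : 'I_m -> Tbar W -> Tbar W) r s :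
    (forall k c d y, y \in tpq c d.+1 -> F k y \in tpq c.+1 d) ->
  forall y, y \in tpq r (m + s) ->
  (\big[(fun f g => f \o g)/idfun]_(k < m) F k) y \in tpq (m + r) s.
  elim: m F s => [|m IHm] F s Fd y Ty; first by rewrite big_ord0.
  rewrite big_ord_recl /=; apply: (Fd); apply: IHm => [k|]; first exact: Fd.
  by rewrite -addSnnS.
rewrite -[p in tpq p]addn0; apply: up => [k c d y|]; first exact: Lmul_vec_tpq.
apply: Lmul_perm_tpq => //; apply: down => [k c d y|]; first exact: Ldual_tpq.
by rewrite addn0.
Qed.

End Q.

Arguments nu {K n n'} g _.
Arguments Q1 K n n' p q _ : clear implicits.
Arguments Q2 K n n' p q _ : clear implicits.

(* Main.v *)
Require Import Defs.
From HB Require Import structures.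
From mathcomp Require Import all_boot all_order all_algebra all_fingroup.
From mathcomp Require Import all_classical reals.
From mathcomp Require Import complex.
From mathcomp Require Import zify.

(** Write S = S_p, N = p + q, V = C^n and V' = C^n', so that W is the tensor product
    of V and V'.

    On a monomial v_p ... v_1 t, a generator of Q2 is computed explicitly
    ([Lop_mono]): it is a sum over r in S of the operator that permutes the vectors
    by r, lets a tensor product of matrix units of End(V') act on them, and replaces
    t by sigma r^-1 t.  It acts on V only by permuting tensor factors, and on t only
    from the left, so it commutes with GL_n and with right multiplications.  This
    gives both easy inclusions.

    An operator commuting with Q1 is determined by its values on the monomials with
    t = 1, and, GL_n-equivariance being expressed on the factors V, Schur-Weyl
    duality ([schur_weyl]) writes it as a combination of permutations of these
    factors, matrix units on the factors V' and left multiplications.  Averaging over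
    S, which does not change a tensor over the group algebra of S, displays it as an
    element of Q2 ([commutant_Q1_sub]).

    The remaining inclusion, that Q1 contains the commutant of Q2, is then the
    bicommutant theorem for Q1.  It holds because Q1 is closed under adjoints: the
    monomials in basis vectors carry a natural Hermitian form, for which the adjoint
    of the action of g is the action of its conjugate transpose, and the adjoint of
    right multiplication by t is right multiplication by t^-1 ([Q1_adjoint]).  The
    bicommutant theorem for algebras of matrices closed under adjoints
    ([star_algebra_bicommutant]) rests on the orthogonal projection onto the algebra.
    It also gives Schur-Weyl duality, applied to the span of the permutation
    operators, whose commutant is spanned by the tensor powers of invertible
    matrices by polarization and density. *)

Set Implicit Arguments.
Unset Strict Implicit.
Unset Printing Implicit Defensive.

Import GRing.Theory Num.Theory.
Local Open Scope ring_scope.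

(** * Bicommutants of star-closed matrix algebras *)

(** Puts a subspace known only through its membership predicate within reach of
    matrix linear algebra: the matrix of largest rank whose rows lie in the
    subspace spans it, since a vector outside its row space would raise the rank. *)
Lemma prop_subspace_rowspace (K : fieldType) m (A : 'rV[K]_m -> Prop) :
  A 0 -> (forall c u v, A u -> A v -> A (c *: u + v)) ->
  exists U : 'M[K]_m, forall u, A u <-> (u <= U)%MS.
Proof.
move=> A0 AZD.
have Amul r (v : 'rV_r) (U : 'M_(r, m)) : (forall i, A (row i U)) -> A (v *m U).
  move=> AU; rewrite mulmx_sum_row; elim/big_rec: _ => // i y _; exact: AZD.
pose P r := `[< exists2 U : 'M[K]_m, forall i, A (row i U) & \rank U = r >].
have P0 : exists r, P r.
  by exists 0%N; apply/asboolP; exists 0; rewrite ?mxrank0 // => i; rewrite row0.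
have Pm r : P r -> (r <= m)%N by move=> /asboolP[U _ <-]; apply: rank_leq_row.
case: (ex_maxnP P0 Pm) => r /asboolP[U AU rU] rmax.
exists U => u; split=> [Au|/submxP[v ->]]; last exact: Amul.
pose V := <<(U + u)%MS>>%MS.
have AV i : A (row i V).
  have /sub_addsmxP[[v w] /= ->] : (row i V <= U + u)%MS.
    by rewrite (submx_trans (row_sub _ _)) ?genmxE.
  rewrite -[v *m U]scale1r; apply: AZD; first exact: Amul.
  by apply: Amul => j; rewrite ord1 row_id.
have /rmax : P (\rank V) by apply/asboolP; exists V.
rewrite -rU mxrank_gen => leVU.
have := mxrank_leqif_sup (addsmxSl U u).
move/geq_leqif; rewrite leVU => /esym.
by rewrite addsmx_sub => /andP[].
Qed.

(** Identifies the trace form on matrices with the dot product of row vectors, for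
    which orthogonal projections are available. *)
Lemma mxtrace_mul_tr (K : comNzRingType) m n (A B : 'M[K]_(m, n)) :
  \tr (A *m B^T) = (mxvec A *m (mxvec B)^T) 0 0.
Proof.
rewrite /mxtrace mxE (reindex _ (curry_mxvec_bij m n)) /=.
under eq_bigr do rewrite mxE.
rewrite pair_bigA; apply: eq_bigr => -[i j] _ /=.
by rewrite !mxE !mxvecE.
Qed.

Local Notation "Z ^H" := (map_mx Num.conj Z)^T (at level 2, format "Z ^H").

Lemma orthogonal_projection (C : numClosedFieldType) d (A : 'M[C]_d -> Prop) :
  A 0 -> (forall c u v, A u -> A v -> A (c *: u + v)) ->
  exists P : {linear 'M[C]_d -> 'M[C]_d},
    [/\ forall X, A (P X),
        forall X Z, A Z -> \tr ((X - P X) *m Z^H) = 0 &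
        forall X Y, A Y -> (forall Z, A Z -> \tr ((X - Y) *m Z^H) = 0) -> P X = Y].
Proof.
move=> A0 AZD.
have [U AU] : exists U : 'M[C]_(d * d), forall u, A (vec_mx u) <-> (u <= U)%MS.
  apply: prop_subspace_rowspace; first by rewrite linear0.
  by move=> c u v Au Av; rewrite linearP; apply: AZD.
exists (vec_mx \o mulmxr (proj_ortho U) \o mxvec); split=> [X|X Z AZ|X Y AY XY].
- by apply/AU; rewrite proj_ortho_sub.
- have ZU : (mxvec Z <= U)%MS by apply/AU; rewrite mxvecK.
  rewrite mxtrace_mul_tr linearB /= vec_mxK -map_mxvec.
  have [D ->] := submxP ZU; rewrite map_mxM trmx_mul mulmxA [(map_mx _ U)^T]map_trmx.
  by rewrite (orthomx1P (proj_ortho_compl_sub _ _)) mul0mx mxE.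
apply: (can_inj mxvecK); rewrite /= vec_mxK.
have YU : (mxvec Y <= U)%MS by apply/AU; rewrite mxvecK.
apply/eqP; rewrite -subr_eq0 -(proj_ortho_id YU) -mulmxBl.
apply/eqP/proj_ortho_0/orthomx1P/rowP => i; rewrite [RHS]mxE.
have /XY : A (vec_mx (row i U)) by apply/AU/row_sub.
rewrite mxtrace_mul_tr linearB /= -map_mxvec vec_mxK => <-.
by rewrite !mxE; apply: eq_bigr => k _; rewrite !mxE.
Qed.

(** Orthogonal *)
(** The bicommutant theorem, for an algebra A with unit e inside a matrix algebra
    whose own unit need not lie in A.  As A is stable under adjoints, left
    multiplication by A preserves the orthogonal complement of A, so the
    orthogonal projection P onto A commutes with left multiplication by A.  Read
    entrywise, P is a family of matrices commuting with A, so P also commutes with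
    left multiplication by f; then f = f e = f P(e) = P(f e) = P(f) lies in A. *)
Lemma star_algebra_bicommutant (C : numClosedFieldType) d (A : 'M[C]_d ->
  Prop) (e f : 'M[C]_d) :
    (forall c a b, A a -> A b -> A (c *: a + b)) ->
    (forall a b, A a -> A b -> A (a *m b)) ->
    (forall a, A a -> A a^H) ->
    A e -> f *m e = f ->
    (forall b, (forall a, A a -> a *m b = b *m a) -> f *m b = b *m f) ->
  A f.
Proof.
move=> AZD AM AJ Ae fe fA''.
have A0 : A 0 by have := AZD (- 1) _ _ Ae Ae; rewrite scaleN1r addNr.
have [P [AP orthP PE]] := orthogonal_projection A0 AZD.
have PM a X : A a -> P (a *m X) = a *m P X.
  move=> Aa; apply: PE => [|Z AZ]; first exact: AM.
  have -> : (a *m X - a *m P X) *m Z^H = a *m ((X - P X) *m Z^H).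
    by rewrite mulmxA mulmxBr.
  rewrite mxtrace_mulC -mulmxA.
  have -> : Z^H *m a = (a^H *m Z)^H.
    rewrite map_mxM trmx_mul; congr (_ *m _); apply/matrixP => i j.
    by rewrite !mxE; apply: esym; exact: conjCK.
  by apply/orthP/AM => //; apply: AJ.
have fP X : f *m P X = P (f *m X).
  have fPd s i : f *m P (delta_mx s i) = P (f *m delta_mx s i).
    apply/matrixP => r j.
    (* b is v |-> (P (v e_i^T)) e_j, a block of P seen as an operator on columns *)
    pose b := \matrix_(r, s) P (delta_mx s i) r j.
    have bE (a : 'M_d) r' s' : (a *m b) r' s' = (a *m P (delta_mx s' i)) r' j.
      by rewrite !mxE; apply: eq_bigr => q _; rewrite !mxE.
    have bE' (a : 'M_d) r' s' : (b *m a) r' s' = P (a *m delta_mx s' i) r' j.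
      have -> : a *m delta_mx s' i = \sum_q a q s' *: delta_mx q i.
        apply/matrixP => k l; rewrite summxE mxE (bigD1 s') //= !mxE eqxx.
        rewrite big1 => [|q qs]; last by rewrite mxE (negPf qs) mulr0.
        rewrite (bigD1 k) //= big1 => [|q qs]; last first.
          by rewrite !mxE eq_sym (negPf qs) mulr0.
        by rewrite !mxE eqxx.
      rewrite linear_sum summxE mxE; apply: eq_bigr => q _.
      by rewrite linearZ !mxE mulrC.
    rewrite -bE -bE' fA'' // => a Aa; apply/matrixP => r' s'.
    by rewrite bE bE' PM.
  rewrite [X in LHS]matrix_sum_delta [X in RHS]matrix_sum_delta.
  rewrite !(linear_sum, mulmx_sumr); apply: eq_bigr => s _.
  rewrite !(linear_sum, mulmx_sumr); apply: eq_bigr => i _.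
  by rewrite !(linearZ, fPd) /= ?(linearZ, fPd).
have Pe : P e = e by apply: PE => // Z _; rewrite subrr mul0mx mxtrace0.
by rewrite -fe -Pe fP.
Qed.

(** * Schur-Weyl duality *)

(** Ryser's inclusion-exclusion formula for the permanent of m: after expanding the
    products over maps f of 'I_p, the coefficient of f is the signed number of
    sets containing the image of f, which vanishes unless f is onto. *)
Lemma polarization (K : comNzRingType) p (m : 'I_p -> 'I_p -> K) :
  \sum_(S : {set 'I_p}) (-1) ^+ #|~: S| * \prod_k \sum_(l in S) m k l
  = \sum_(s : 'S_p) \prod_k m k (s k).
Proof.
transitivity (\sum_(f : {ffun 'I_p -> 'I_p})
    (\sum_(S : {set 'I_p} | f @: 'I_p \subset S) (-1) ^+ #|~: S|)
    * \prod_k m k (f k)).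
  under eq_bigr do rewrite bigA_distr_big big_distrr /=.
  rewrite (exchange_big_dep predT) //=; apply: eq_bigr => f _.
  rewrite -mulr_suml; congr (_ * _); apply: eq_bigl => S.
  apply/idP/idP => [/ffun_onP fS|/fintype.subsetP fS]; last first.
    by apply/ffun_onP => k; apply: fS; apply: imset_f.
  by apply/fintype.subsetP => _ /imsetP[k _ ->]; apply: fS.
have signE (f : {ffun 'I_p -> 'I_p}) :
    \sum_(S : {set 'I_p} | f @: 'I_p \subset S) (-1) ^+ #|~: S|
    = (injectiveb f)%:R :> K.
  have -> : injectiveb f = (f @: 'I_p == [set: 'I_p]).
    rewrite eqEcard finset.subsetT cardsT /=.
    apply/injectiveP/idP => [fI|lef]; first by rewrite card_imset.
    have /imset_injP fI : #|f @: 'I_p| == #|'I_p|.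
      by rewrite eqn_leq leq_imset_card.
    by move=> x y; apply: fI.
  (* S collects the factors in which 1 is chosen when the product is expanded *)
  transitivity (\prod_l (1 - (l \notin f @: 'I_p)%:R : K)).
    rewrite bigA_distr big_mkcond /=; apply: eq_bigr => S _.
    rewrite [RHS](bigID (mem S)) /= [X in X * _]big1 ?mul1r => [|l ->//].
    case: ifPn => [fS|/fintype.subsetPn[l fl lS]].
      rewrite -prodr_const; apply: eq_big => [l|l lS]; first by rewrite inE.
      rewrite inE in lS; rewrite (negPf lS) (contraNN (fintype.subsetP fS l) lS) //.
    by rewrite (bigD1 l lS) /= (negPf lS) fl oppr0 mul0r.
  case: eqVneq => [->|/eqP fT].
    by rewrite big1 // => l _; rewrite finset.in_setT subr0.
  have [l fl] : exists l, l \notin f @: 'I_p.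
    apply/existsP; rewrite -negb_forall; apply/forallP => fT'.
    by apply: fT; apply/finset.setP => l; rewrite fT' finset.in_setT.
  by rewrite (bigD1 l) //= fl subrr mul0r.
under eq_bigr do rewrite signE.
rewrite (bigID (fun f : {ffun 'I_p -> 'I_p} => injectiveb f)) /= addrC big1 ?add0r =>
  [|f /negPf->].
  rewrite (reindex (@pval _)) /=; last first.
    pose in_Sn := insubd (1%g : 'S_p).
    by exists in_Sn => /= f Uf; first apply: val_inj; apply: insubdK.
  by apply: eq_big => /= [s | s _]; rewrite (valP s) // ?mul1r pvalE.
by rewrite mul0r.
Qed.

Section TensorPower.
Variables (K : fieldType) (n p : nat).
Notation Y := {ffun 'I_p -> 'I_n}.
Implicit Types k l : Y -> Y -> K.

(** Operators on the p-th tensor power of K^n are handled as kernels on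
    multi-indices, and [tens_pow g] is the kernel of the p-th tensor power of g. *)
Definition kmul k l (y z : Y) : K := \sum_u k y u * l u z.
Definition tens_pow (g : 'M[K]_n) (y z : Y) : K := \prod_m g (y m) (z m).
Definition kcomm k l := forall y z, kmul k l y z = kmul l k y z.
Definition permute (y : Y) (s : 'S_p) : Y := [ffun m => y (s m)].

Lemma permute1 y : permute y 1%g = y.
Proof. by apply/ffunP => m; rewrite ffunE perm1. Qed.

Lemma permute_comp y r s : permute (permute y r) s = permute y (s * r)%g.
Proof. by apply/ffunP => m; rewrite !ffunE permM. Qed.

Lemma permuteK s : cancel (permute^~ s) (permute^~ s^-1%g).
Proof. by move=> y; rewrite permute_comp mulVg permute1. Qed.

Lemma permuteVK s : cancel (permute^~ s^-1%g) (permute^~ s).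
Proof. by move=> y; rewrite permute_comp mulgV permute1. Qed.

Lemma permute_inj s : injective (permute^~ s).
Proof. exact: can_inj (permuteK s). Qed.

Lemma kcomm_sum (I : finType) (P : pred I) (c : I -> K) k (l : I -> Y -> Y -> K) :
  (forall i, P i -> kcomm k (l i)) -> kcomm k (fun y z => \sum_(i | P i) c i * l i y z).
Proof.
move=> kl y z; rewrite /kmul.
transitivity (\sum_(i | P i) c i * kmul k (l i) y z).
  under eq_bigr do rewrite mulr_sumr.
  rewrite exchange_big; apply: eq_bigr => i _; rewrite /= mulr_sumr.
  by apply: eq_bigr => u _; rewrite mulrCA.
under eq_bigr => i Pi do rewrite kl //.
under [RHS]eq_bigr do rewrite mulr_suml.
rewrite [RHS]exchange_big; apply: eq_bigr => i _; rewrite /= mulr_sumr.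
by apply: eq_bigr => u _; rewrite mulrA.
Qed.

Hypothesis K0 : [pchar K] =i pred0.

Lemma poly_eval_eq0 (r : {poly K}) : (forall t, r.[t] = 0) -> r = 0.
Proof.
move=> r0; apply/eqP; apply: contraT => rn0.
have := @max_poly_roots _ r [seq i%:R | i <- iota 0 (size r)] rn0.
rewrite size_map size_iota ltnn; apply.
  by apply/allP => _ /mapP[i _ ->]; apply/rootP.
rewrite map_inj_uniq ?iota_uniq // => i j.
move/pcharf0P: K0 => K0'.
wlog ij : i j / (i <= j)%N.
  by move=> H; case/orP: (leq_total i j) => ij; [|move/esym] => /H -> //.
move=> /esym/eqP; rewrite -subr_eq0 -natrB // K0' subn_eq0 => ji.
by apply/eqP; rewrite eqn_leq ij.
Qed.

(** GL_n is dense *)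
(** GL_n is Zariski dense: an entry of the commutator of k with the tensor power
    of g + t is a polynomial in t that vanishes where det (g + t) does not.  Its
    product with det (g + t) vanishes identically, hence it is zero, because
    det (g + t) is a characteristic polynomial.  Then take t = 0. *)
Lemma kcomm_tens_pow_unit k :
  (forall g, g \in unitmx -> kcomm k (tens_pow g)) -> forall g, kcomm k (tens_pow g).
Proof.
move=> kg g y z.
pose G := char_poly_mx (- g).
pose T (y z : Y) := \prod_m G (y m) (z m).
pose r := \sum_u ((k y u)%:P * T u z) - \sum_u (T y u * (k u z)%:P).
have GE t i j : (G i j).[t] = (g + t%:M) i j.
  by rewrite /G /char_poly_mx !mxE hornerD hornerN hornerMn hornerX hornerC opprK addrC.
have TE t u v : (T u v).[t] = tens_pow (g + t%:M) u v.
  by rewrite horner_prod; apply: eq_bigr => m _; rewrite GE.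
have rE t : r.[t] = kmul k (tens_pow (g + t%:M)) y z - kmul (tens_pow (g + t%:M)) k y z.
  rewrite hornerD hornerN !horner_sum; congr (_ - _); apply: eq_bigr => u _.
    by rewrite hornerM hornerC TE.
  by rewrite hornerM hornerC TE.
have r0 : r * \det G = 0.
  apply: poly_eval_eq0 => t; rewrite hornerM rE.
  have -> : (\det G).[t] = \det (g + t%:M).
    rewrite -horner_evalE -det_map_mx; congr (\det _); apply/matrixP => i j.
    by rewrite mxE [LHS]GE.
  have [g0|gN0] := eqVneq (\det (g + t%:M)) 0; first by rewrite g0 mulr0.
  by rewrite kg ?subrr ?mul0r // unitmxE unitfE.
move/eqP: r0; rewrite mulf_eq0 [\det G == 0]negbTE ?orbF; last first.
  exact: monic_neq0 (char_poly_monic _).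
move=> /eqP r0; have := rE 0; rewrite r0 horner0 raddf0 addr0.
by move/esym/eqP; rewrite subr_eq0 => /eqP.
Qed.

(** polarization *)
(** The tensor powers of matrices span the operators that commute with S_p: such an
    operator is an average of symmetrized tensors of matrix units, and each of those
    is a signed sum of tensor powers by [polarization]. *)
Lemma kcomm_symmetric k b :
    (forall g, kcomm k (tens_pow g)) ->
    (forall s y z, b (permute y s) (permute z s) = b y z) ->
  kcomm k b.
Proof.
move=> kg bS.
(* the symmetrization of the tensor product of the matrix units (y m, z m) *)
pose E (y z u v : Y) : K := \sum_(s : 'S_p) ((u == permute y s) && (v == permute z s))%:R.
have kE y z : kcomm k (E y z).
  pose g (S : {set 'I_p}) := \sum_(m in S) delta_mx (y m) (z m) : 'M[K]_n.
  have -> : E y z = fun u v => \sum_(S : {set 'I_p}) (-1) ^+ #|~: S| * tens_pow (g S) u v.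
    apply/funext => u; apply/funext => v.
    pose m i j : K := ((u i == y j) && (v i == z j))%:R.
    transitivity (\sum_(s : 'S_p) \prod_i m i (s i)).
      apply: eq_bigr => s _; rewrite /m.
      case: (boolP [forall i, (u i == y (s i)) && (v i == z (s i))]) => [/forallP uv|].
        rewrite big1 => [|i _]; last by rewrite uv.
        rewrite (_ : u = permute y s) 1?(_ : v = permute z s) ?eqxx //.
          by apply/ffunP => i; rewrite ffunE; have /andP[_ /eqP] := uv i.
        by apply/ffunP => i; rewrite ffunE; have /andP[/eqP] := uv i.
      rewrite negb_forall => /existsP[i uvi]; rewrite (bigD1 i) //= (negPf uvi) mul0r.
      case: andP => // -[/eqP uE /eqP vE].
      by rewrite uE vE !ffunE !eqxx in uvi.
    rewrite -polarization; apply: eq_bigr => S _; congr (_ * _).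
    apply: eq_bigr => i _.
    by rewrite summxE; apply: eq_bigr => j _; rewrite mxE.
  exact: kcomm_sum.
have pE : b = fun u v => \sum_(w : Y * Y) ((p`!)%:R^-1 * b w.1 w.2) * E w.1 w.2 u v.
  apply/funext => u; apply/funext => v.
  transitivity (\sum_(s : 'S_p) (p`!)%:R^-1 * b u v).
    rewrite sumr_const card_Sn -[in RHS](mulr_natl (_ * _)) mulrA mulfV ?mul1r //.
    by move/pcharf0P: K0 => ->; rewrite -lt0n fact_gt0.
  under [RHS]eq_bigr do rewrite mulr_sumr.
  rewrite exchange_big; apply: eq_bigr => s _ /=.
  rewrite (bigD1 (permute u s^-1%g, permute v s^-1%g)) //=.
  have ypK w : permute (permute w s^-1%g) s = w.
    by apply/ffunP => i; rewrite !ffunE permK.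
  rewrite !ypK !eqxx mulr1 bS big1 ?addr0 // => -[w w'] /= ww.
  case: andP => [[/eqP uE /eqP vE]|_]; last by rewrite mulr0.
  case/eqP: ww; congr pair; apply/ffunP => i; rewrite ffunE.
    by rewrite uE ffunE permKV.
  by rewrite vE ffunE permKV.
by rewrite pE; apply: kcomm_sum => w _; apply: kE.
Qed.
End TensorPower.

Section Kernels.
Variables (C : numClosedFieldType) (T : finType).
Implicit Types k l : T -> T -> C.

Definition kmx k : 'M[C]_#|T| :=
  \matrix_(i, j) k (enum_val i) (enum_val j).

Lemma kmxM k l :
  kmx k *m kmx l = kmx (fun x z => \sum_y k x y * l y z).
Proof.
apply/matrixP => i j; rewrite !mxE [RHS]big_enum_val.
by apply: eq_bigr => y _; rewrite !mxE.
Qed.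

Lemma kmxK (a : 'M[C]_#|T|) :
  a = kmx (fun x y => a (enum_rank x) (enum_rank y)).
Proof. by apply/matrixP => i j; rewrite mxE !enum_valK. Qed.

Lemma kmx_inj k l : kmx k = kmx l -> forall x y, k x y = l x y.
Proof.
move=> kl x y; have := congr1 (fun a => fun_of_matrix a (enum_rank x) (enum_rank y)) kl.
by rewrite !mxE !enum_rankK.
Qed.

End Kernels.

Section SchurWeyl.
Variables (C : numClosedFieldType) (n p : nat).
Notation Y := {ffun 'I_p -> 'I_n}.

(** The span of the permutation operators is a star-closed algebra, so by the
    bicommutant theorem it contains every k commuting with its commutant; the latter
    consists of the symmetric kernels, and [kcomm_symmetric] applies to them. *)
Lemma schur_weyl (k : Y -> Y -> C) :
  (forall g, g \in unitmx -> kcomm k (tens_pow g)) ->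
  exists c : 'S_p -> C, forall y z, k y z = \sum_s c s * (z == permute y s)%:R.
Proof.
move=> /(kcomm_tens_pow_unit (pchar_num C)) kg.
pose L (c : 'S_p -> C) (y z : Y) := \sum_s c s * (z == permute y s)%:R.
have L1 r y z : L (fun s => (s == r)%:R) y z = (z == permute y r)%:R.
  rewrite /L (bigD1 r) //= eqxx mul1r big1 ?addr0 // => s /negPf->.
  by rewrite mul0r.
suff [c cE] : exists c, kmx k = kmx (L c) by exists c; apply: kmx_inj.
apply: (@star_algebra_bicommutant _ _ (fun a => exists c, a = kmx (L c)) 1%:M).
- move=> t _ _ [c ->] [d ->]; exists (fun s => t * c s + d s).
  apply/matrixP => i j; rewrite !mxE mulr_sumr -big_split; apply: eq_bigr => s _ /=.
  by rewrite mulrDl mulrA.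
- move=> _ _ [c ->] [d ->].
  exists (fun s => \sum_r c r * d (s * r^-1)%g).
  rewrite kmxM; congr kmx; apply/funext => y; apply/funext => z.
  transitivity (\sum_r c r * L d (permute y r) z).
    under eq_bigr do rewrite mulr_suml.
    rewrite exchange_big; apply: eq_bigr => r _ /=.
    rewrite (bigD1 (permute y r)) //= eqxx mulr1 big1 ?addr0 // => u /negPf->.
    by rewrite mulr0 mul0r.
  under [RHS]eq_bigr do rewrite mulr_suml.
  rewrite [RHS]exchange_big; apply: eq_bigr => r _ /=.
  rewrite mulr_sumr [RHS](reindex_inj (mulIg r)); apply: eq_bigr => s _ /=.
  by rewrite permute_comp mulgK mulrA.
- move=> _ [c ->]; exists (fun s => (c s^-1%g)^*).
  apply/matrixP => i j; rewrite !mxE rmorph_sum (reindex_inj invg_inj) /=.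
  apply: eq_bigr => s _; rewrite rmorphM rmorph_nat; congr (_ * _%:R).
  by rewrite -(inj_eq (@permute_inj _ _ s)) permuteVK eq_sym.
- exists (fun s => (s == 1%g)%:R).
  apply/matrixP => i j; rewrite !mxE L1 permute1 (inj_eq enum_val_inj) eq_sym //.
- by rewrite mulmx1.
- move=> b bA; rewrite (kmxK b) !kmxM; congr kmx.
  apply/funext => y; apply/funext => z.
  pose b' (u v : Y) := b (enum_rank u) (enum_rank v).
  apply: (@kcomm_symmetric _ _ _ (pchar_num C) k b' kg) => s {}y {}z.
  have /bA : exists c, kmx (fun y z => (z == permute y s)%:R) = kmx (L c).
    exists (fun r => (r == s)%:R); congr kmx; apply/funext => u; apply/funext => v.
    by rewrite L1.
  rewrite (kmxK b) !kmxM => /kmx_inj/(_ y (permute z s)).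
  rewrite (bigD1 (permute y s)) //= eqxx mul1r big1 ?addr0; last first.
    by move=> u /negPf ->; rewrite mul0r.
  rewrite /b' => ->; rewrite (bigD1 z) //= eqxx mulr1 big1 ?addr0 // => u.
  by rewrite (inj_eq (@permute_inj _ _ s)) eq_sym => /negPf->; rewrite mulr0.
Qed.
End SchurWeyl.

(** * Sequences of vectors and finite permutations *)

Section Ext.
Variable N : nat.
Implicit Types s r : 'S_N.

Let perm_extf s (k : nat) : nat := if insub k is Some i then val (s i) else k.

Fact finperm_perm_ext s : finperm (perm_extf s).
Proof.
have perm_extfK r : cancel (perm_extf r) (perm_extf r^-1%g).
  move=> k; rewrite /perm_extf; case: (insubP 'I_N k) => [i _ <-|/negPf kN].
    by rewrite valK permK.
  by rewrite insubF.
apply/asboolP; split.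
  by exists (perm_extf s^-1%g) => //; rewrite -{2}[s]invgK; apply: perm_extfK.
by exists N => k; rewrite leqNgt => /negPf kN; rewrite /perm_extf insubF.
Qed.

Definition perm_ext s : Sinf := MkSinf (finperm_perm_ext s).

Lemma perm_ext_ord s (i : 'I_N) : perm_ext s i = s i :> nat.
Proof. by rewrite /= /perm_extf valK. Qed.

Lemma inS_perm_ext s : inS N (perm_ext s).
Proof. by move=> k; rewrite leqNgt => /negPf kN; rewrite /= /perm_extf insubF. Qed.

Lemma inS_eq (t u : Sinf) : inS N t -> inS N u -> (forall i : 'I_N, t i = u i) -> t = u.
Proof.
move=> tN uN tu; apply: sinfP => k; case: (ltnP k N) => kN.
  exact: (tu (Ordinal kN)).
by rewrite tN // uN.
Qed.

Lemma perm_ext_inj : injective perm_ext.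
Proof.
move=> s r sr; apply/permP => i; apply: val_inj.
by rewrite /= -!perm_ext_ord sr.
Qed.

(** The order is reversed because the product of 'S_N is opposite to composition. *)
Lemma perm_extM s r : perm_ext (s * r)%g = (perm_ext r * perm_ext s)%g.
Proof.
apply: inS_eq => [||i]; [exact: inS_perm_ext|apply: inSM; exact: inS_perm_ext|].
by rewrite sinfM !perm_ext_ord permM.
Qed.

Lemma perm_ext1 : perm_ext 1%g = 1%g.
Proof. by apply: (mulgI (perm_ext 1%g)); rewrite -perm_extM !mulg1. Qed.

Lemma perm_extV s : perm_ext s^-1%g = (perm_ext s)^-1%g.
Proof. by apply: (mulgI (perm_ext s)); rewrite -perm_extM mulVg mulgV perm_ext1. Qed.

Lemma inS_extP t : inS N t -> exists s, t = perm_ext s.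
Proof.
move=> tN; pose f (i : 'I_N) := Ordinal (inS_ltn tN (ltn_ord i)).
have fI : injective f by move=> i j [] /sinf_inj /val_inj.
exists (perm fI); apply: inS_eq => [//||i]; first exact: inS_perm_ext.
by rewrite perm_ext_ord permE.
Qed.

End Ext.

Lemma linear_sumZ (K : fieldType) (M N : lmodType K) (f : M -> N)
    (I : finType) (P : pred I) (c : I -> K) (u : I -> M) :
  linear f -> f (\sum_(i | P i) c i *: u i) = \sum_(i | P i) c i *: f (u i).
Proof.
move=> lf; pose L := GRing.isLinear.Build _ _ _ _ f lf.
pose f' : {linear M -> N} := HB.pack f L.
by rewrite -[f]/(f' : M -> N) linear_sum; apply: eq_bigr => i _; rewrite linearZ.
Qed.

Section Words.
Variables (K : fieldType) (V : lmodType K).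
Implicit Types (t : Sinf).

Definition famseq p (v : 'I_p -> V) : seq V := [seq v k | k <- enum 'I_p].

Lemma size_famseq p (v : 'I_p -> V) : size (famseq v) = p.
Proof. by rewrite size_map size_enum_ord. Qed.

Lemma nth_famseq p (v : 'I_p -> V) (k : 'I_p) : nth 0 (famseq v) k = v k.
Proof. by rewrite (nth_map k) ?size_enum_ord // nth_ord_enum. Qed.

Lemma famseqP p (s : seq V) : size s = p -> s = famseq (fun k : 'I_p => nth 0 s k).
Proof.
move=> sp; apply: (@eq_from_nth _ 0) => [|k ks]; first by rewrite size_famseq.
rewrite sp in ks; exact: esym (nth_famseq _ (Ordinal ks)).
Qed.

Lemma eq_famseq p (u v : 'I_p -> V) : u =1 v -> famseq u = famseq v.
Proof. by move=> uv; apply: eq_map. Qed.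

Lemma famseq_recl p (v : 'I_p.+1 -> V) : famseq v = v ord0 :: famseq (fun k =>
  v (lift ord0 k)).
Proof. by rewrite /famseq enum_ordSl /= -map_comp. Qed.

Lemma wact_famseq p (v : 'I_p -> V) (s : 'S_p) :
  wact (famseq v) (perm_ext s) = famseq (fun k => v (s k)).
Proof.
apply: (@eq_from_nth _ 0); first by rewrite size_wact !size_famseq.
move=> k; rewrite size_wact size_famseq => kp.
rewrite nth_wact ?size_famseq // (nth_famseq _ (Ordinal kp)).
by rewrite (perm_ext_ord s (Ordinal kp)) nth_famseq.
Qed.

(** The balancing relation of the tensor product over the group algebra of S_p. *)
Lemma mono_famseq_perm p (v : 'I_p -> V) (s : 'S_p) t :
  mono (famseq (fun k => v (s k))) t = mono (famseq v) (perm_ext s * t)%g.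
Proof. by rewrite -wact_famseq mono_bal // size_famseq; apply: inS_perm_ext. Qed.

Lemma mono_linear_entry s1 s2 t : linear (fun v : V => mono (s1 ++ v :: s2) t).
Proof. by move=> a u v; rewrite mono_lin. Qed.

Lemma big_ffun_recl (M : nmodType) (J : finType) p (F : {ffun 'I_p.+1 -> J} -> M) :
  \sum_f F f = \sum_j \sum_(f : {ffun 'I_p -> J})
    F [ffun k => if unlift ord0 k is Some k' then f k' else j].
Proof.
pose h (x : J * {ffun 'I_p -> J}) := [ffun k =>
  if unlift ord0 k is Some k' then x.2 k' else x.1].
rewrite (reindex h) /= -?(pair_bigA _ (fun j f => F (h (j, f)))) //.
exists (fun f : {ffun 'I_p.+1 -> J} => (f ord0, [ffun k => f (lift ord0 k)])).
  move=> [j f] _; rewrite /h /= ffunE unlift_none; congr pair.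
  by apply/ffunP => k; rewrite !ffunE liftK.
move=> f _; apply/ffunP => k; rewrite !ffunE /=.
by case: unliftP => [k' ->|->]; rewrite ?ffunE.
Qed.

(** The prefix s, left untouched, is what makes the induction on p go through. *)
Lemma mono_expand_prefix (J : finType) p (c : 'I_p -> J -> K) (w : 'I_p -> J -> V) s t :
  mono (s ++ famseq (fun k => \sum_j c k j *: w k j)) t
  = \sum_(f : {ffun 'I_p -> J}) (\prod_k c k (f k)) *: mono (s ++ famseq (fun k =>
    w k (f k))) t.
Proof.
elim: p c w s => [|p IHp] c w s.
  rewrite (big_pred1 (ffun0 (card_ord 0))) => [|f]; last first.
    by apply/esym/eqP/ffunP => -[].
  by rewrite big_ord0 scale1r /famseq enum_ord0.
rewrite famseq_recl.
rewrite (linear_sumZ _ _ _ (mono_linear_entry s _ t)) big_ffun_recl.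
apply: eq_bigr => j _.
rewrite -cat_rcons IHp scaler_sumr; apply: eq_bigr => f _.
rewrite big_ord_recl !ffunE unlift_none scalerA famseq_recl !ffunE unlift_none.
rewrite cat_rcons; congr (_ * _ *: mono (_ ++ _ :: _) _).
  by apply: eq_bigr => k _; rewrite ffunE liftK.
by apply: eq_famseq => k; rewrite ffunE liftK.
Qed.

Lemma mono_expand (J : finType) p (c : 'I_p -> J -> K) (w : 'I_p -> J -> V) t :
  mono (famseq (fun k => \sum_j c k j *: w k j)) t
  = \sum_(f : {ffun 'I_p -> J}) (\prod_k c k (f k)) *: mono (famseq (fun k => w k (f k))) t.
Proof. exact: (mono_expand_prefix c w [::]). Qed.

Lemma mono_famseq0 p (v : 'I_p -> V) k t : v k = 0 -> mono (famseq v) t = 0.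
Proof.
move=> vk0.
have -> : famseq v = famseq (fun m => \sum_(j < 1) (m != k)%:R *: v m).
  by apply: eq_famseq => m; rewrite big_ord1; case: eqVneq => [->|_];
    rewrite ?vk0 ?scale0r ?scale1r.
rewrite (mono_expand (fun m _ => (m != k)%:R) (fun m _ => v m)) big1 // => f _.
by rewrite (bigD1 k) //= eqxx mul0r scale0r.
Qed.

Lemma famseq_recr p (v : 'I_p.+1 -> V) :
  famseq v = rcons (famseq (fun k => v (widen_ord (leqnSn p) k))) (v ord_max).
Proof. by rewrite /famseq enum_ordSr map_rcons -map_comp. Qed.

Lemma Lmul_word p (v : 'I_p -> V) s t :
  (\big[(fun f g => f \o g)/idfun]_(k < p) Lmul (tvec (v (rev_ord k)))) (mono s t)
  = mono (s ++ famseq v) t.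
Proof.
elim: p v => [|p IHp] v; first by rewrite big_ord0 /famseq enum_ord0 cats0.
rewrite big_ord_recl /=.
have -> : rev_ord ord0 = ord_max :> 'I_p.+1 by apply: val_inj; rewrite /= subn1.
rewrite (eq_bigr (fun k => Lmul (tvec (v (widen_ord (leqnSn p) (rev_ord k)))))); last first.
  by move=> k _; congr (Lmul (tvec (v _))); apply: val_inj.
by rewrite (IHp (fun k => v (widen_ord (leqnSn p) k))) Lmul_vec rcons_cat -famseq_recr.
Qed.

Lemma big_comp_recr (T : Type) p (F : 'I_p.+1 -> T -> T) :
  \big[(fun f g => f \o g)/idfun]_(k < p.+1) F k
  = (\big[(fun f g => f \o g)/idfun]_(k < p) F (widen_ord (leqnSn p) k)) \o F ord_max.
Proof.
elim: p F => [|p IHp] F.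
  rewrite big_ord_recl !big_ord0; have -> : ord0 = ord_max :> 'I_1 by apply: val_inj.
  by [].
rewrite big_ord_recl IHp [in RHS]big_ord_recl.
rewrite (eq_bigr (fun k => F (widen_ord (leqnSn p.+1) (lift ord0 k)))) /=; last first.
  by move=> k _; congr F; apply: val_inj.
have -> : lift ord0 ord_max = ord_max :> 'I_p.+2 by apply: val_inj.
have -> : widen_ord (leqnSn p.+1) ord0 = ord0 by apply: val_inj.
by [].
Qed.

Lemma big_comp_linear (M : lmodType K) p (F : 'I_p -> M -> M) :
  (forall k, linear (F k)) -> linear (\big[(fun f g => f \o g)/idfun]_(k < p) F k).
Proof.
move=> lF; elim/big_rec: _ => [//|k f _ lf] a x y /=.
by rewrite lf lF.
Qed.

Lemma sum_perm_recr (M : nmodType) p (F : 'S_p.+1 -> M) :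
  \sum_s F s = \sum_(k < p.+1) \sum_(s : 'S_p) F (lift_perm ord_max k s).
Proof.
pose h (x : 'I_p.+1 * 'S_p) := lift_perm ord_max x.1 x.2.
rewrite (reindex h); first by rewrite -(pair_bigA _ (fun k s => F (h (k, s)))).
apply: onW_bij; apply: inj_card_bij => [[k s] [l r] hE|].
  have /= kl : h (k, s) ord_max = h (l, r) ord_max by rewrite hE.
  rewrite /h /= !lift_perm_id in kl; rewrite {}kl in hE *; congr pair; apply/permP => j.
  have : h (l, s) (lift ord_max j) = h (l, r) (lift ord_max j) by rewrite hE.
  by rewrite !lift_perm_lift => /lift_inj.
by rewrite card_prod !card_Sn card_ord factS.
Qed.

(** Choosing the vector paired with the last dual vector, then pairing the others
    by s, amounts to pairing by [lift_perm ord_max k s]; the cycle in the definition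
    of the dual operators is exactly the discrepancy between the two permutations. *)
Lemma cyc_lift_perm p (k : 'I_p.+1) (s : 'S_p) :
  (cyc p.+1 k * perm_ext (lift_perm ord_max k s))%g = perm_ext s.
Proof.
apply: (@inS_eq p.+1) => [||i].
- by apply: inSM; [apply: inS_cyc|apply: inS_perm_ext].
- by apply: inS_le (leqnSn p) _; apply: inS_perm_ext.
rewrite sinfM perm_ext_ord; case: (unliftP ord_max i) => [j ->|->].
  rewrite lift_perm_lift lift_max perm_ext_ord /= /bump.
  have := ltn_ord (s j); set x := nat_of_ord (s j) => xp.
  case: (leqP k x) => kx; rewrite ?add1n ?add0n.
    have -> : (k <= x.+1 < p.+1)%N by lia.
    by have /negPf-> : x.+1 != k by lia.
  by rewrite leqNgt kx.
rewrite lift_perm_id /= leqnn eqxx ltn_ord; apply: esym; exact: inS_perm_ext.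
Qed.

Lemma nth_del_bump (s : seq V) k m : (k < size s)%N ->
  nth 0 (del k s) m = nth 0 s (bump k m).
Proof.
move=> ks; rewrite /del nth_cat size_take ks /bump.
case: (ltnP m k) => mk; first by rewrite nth_take.
by rewrite nth_drop; congr nth; lia.
Qed.

(** By induction on p, peeling off the innermost operator, which is applied first
    and pairs the last dual vector. *)
Lemma Ldual_word p (f : 'I_p -> {linear V -> K^o}) s t : size s = p ->
  (\big[(fun f g => f \o g)/idfun]_(k < p) Ldual (f k)) (mono s t)
  = \sum_(r : 'S_p) (\prod_k (f k (nth 0 s (r k)) : K)) *: mono [::] ((perm_ext r)^-1 *
    t)%g.
Proof.
elim: p f s t => [|p IHp] f s t sp.
  rewrite (big_pred1 1%g) => [|r]; last by apply/esym/eqP/permP => -[].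
  by rewrite !big_ord0 perm_ext1 invg1 mul1g scale1r (size0nil sp).
rewrite big_comp_recr /= Ldual_mono sp linear_sumZ; last first.
  by apply: big_comp_linear => k; apply: Ldual_linear.
rewrite sum_perm_recr; apply: eq_bigr => k _.
rewrite IHp; last by rewrite size_del sp.
rewrite scaler_sumr; apply: eq_bigr => r _.
rewrite scalerA big_ord_recr /= lift_perm_id mulrC; congr (_ * _ *: mono _ _).
  apply: eq_bigr => j _; rewrite nth_del_bump ?sp //.
  have -> : widen_ord (leqnSn p) j = lift ord_max j by apply: val_inj;
    exact: esym (lift_max j).
  by rewrite lift_perm_lift.
by rewrite mulgA -(cyc_lift_perm k) invMg mulgKV.
Qed.

End Words.

(** * The operators of Q2 on monomials *)

Section LopE.
Variables (K : fieldType) (n n' p : nat).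
Notation W := 'M[K]_(n, n').

Definition word (i : 'I_p -> 'I_n) (a : 'I_p -> 'I_n') : seq W :=
  famseq (fun k => wvec K (i k) (a k)).

(** Summing over the indices i contracts each w*_(i b) with w_(i a) into the matrix
    unit sending the b-th basis vector of the second factor of W to the a-th one.
    As these act on the right, they commute with the action of GL_n. *)
Lemma Lop_mono (a b : 'I_p -> 'I_n') u (s : seq W) t : size s = p ->
  Lop a b u (mono s t) = \sum_(r : 'S_p)
    mono (famseq (fun k => nth 0 s (r k) *m delta_mx (b k) (a k))) (u * (perm_ext r)^-1 *
      t)%g.
Proof.
move=> sp.
transitivity (\sum_(i : {ffun 'I_p -> 'I_n}) \sum_(r : 'S_p)
    (\prod_k (nth 0 s (r k) : W) (i k) (b k)) *: mono (word i a) (u * (perm_ext r)^-1 *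
      t)%g).
  apply: eq_bigr => i _; rewrite /= /Lwdual.
  rewrite (Ldual_word (fun k => wdual (i k) (b k) : {linear _ -> _})) // linear_sum /= /Lw.
  rewrite (eq_bigr (fun r : 'S_p => (\prod_k (nth 0 s (r k) : W) (i k) (b k)) *:
    mono [::] (u * (perm_ext r)^-1 * t)%g)); last first.
    by move=> r _; rewrite linearZ /= Lmul_perm mulgA.
  rewrite linear_sumZ; last by apply: big_comp_linear => k; apply: linearP.
  by apply: eq_bigr => r _; rewrite (Lmul_word (fun k => wvec K (i k) (a k))).
rewrite exchange_big; apply: eq_bigr => r _ /=.
rewrite -(mono_expand (fun k (j : 'I_n) => (nth 0 s (r k) : W) j (b k)) (fun k j =>
  wvec K j (a k))).
congr mono; apply: eq_famseq => k; apply/matrixP => x y; rewrite summxE mxE.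
rewrite (bigD1 x) //= (bigD1 (b k)) //= !mxE !eqxx /= !big1 ?addr0 // => z.
  by rewrite !mxE => /negPf ->; rewrite mulr0.
by rewrite !mxE => /negPf zx; rewrite eq_sym zx mulr0.
Qed.
End LopE.

(** * A symmetric frame of monomials *)

Lemma regular_scaleE (K : fieldType) (c : K) (x : K^o) : c *: x = c * x.
Proof. by []. Qed.

Section Coordinates.
Variables (K : fieldType) (n n' p : nat).
Hypothesis K0 : [pchar K] =i pred0.
Notation W := 'M[K]_(n, n').
Implicit Types (i j : 'I_p -> 'I_n) (a b : 'I_p -> 'I_n') (u t : Sinf).

Lemma fact_neq0 m : (m`!)%:R != 0 :> K.
Proof. by move/pcharf0P: K0 => ->; rewrite -lt0n fact_gt0. Qed.

(** The coefficient at (i, a, u) of the average of the p! expressions of a tensor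
    that differ by the balancing relation.  Averaging makes it well defined on the
    quotient, and makes the coordinate of one monomial at another symmetric. *)
Definition wcoord0 i a u (x : seq W * Sinf) : K^o :=
  if size x.1 == p then
    (p`!)%:R^-1 * \sum_(r : 'S_p) (u == (perm_ext r)^-1 * x.2)%g%:R *
      \prod_k (nth 0 x.1 (r k) : W) (i k) (a k)
  else 0.

Lemma wcoord0_compat i a u : compat (wcoord0 i a u).
Proof.
split=> [s1 s2 c v w t|s t t' st]; rewrite /wcoord0 /=.
  rewrite !size_cat /=; case: eqP => [sp|_]; last by rewrite scaler0 addr0.
  rewrite regular_scaleE mulrCA -mulrDr; congr (_ * _).
  rewrite mulr_sumr -big_split; apply: eq_bigr => r _ /=.
  rewrite mulrCA -mulrDr; congr (_ * _).
  have s1p : (size s1 < p)%N by rewrite -sp addnS ltnS leq_addr.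
  pose k0 := (r^-1)%g (Ordinal s1p).
  have prodE (x : W) : \prod_k (nth 0 (s1 ++ x :: s2) (r k) : W) (i k) (a k)
      = x (i k0) (a k0) * \prod_(k | k != k0) (nth 0 (s1 ++ 0 :: s2) (r k) : W) (i k) (a k).
    rewrite (bigD1 k0) //= permKV nth_cat ltnn subnn; congr (_ * _).
    apply: eq_bigr => k kk0; rewrite !nth_cat.
    case: ltngtP => // [sk|sk]; first by rewrite -(subnSK sk).
    by case/eqP: kk0; apply: (canRL (permK r)); apply: val_inj.
  by rewrite !prodE !mxE mulrDl mulrA.
rewrite size_wact; case: eqP => // sp; congr (_ * _).
have [r0 tE] := inS_extP (N := p) (eq_ind _ (fun m => inS m t) st _ sp).
rewrite [RHS](reindex_inj (mulIg r0)); apply: eq_bigr => r _ /=; congr (_%:R * _).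
  by rewrite perm_extM tE invMg mulgA mulgKV.
by apply: eq_bigr => k _; rewrite nth_wact ?sp // permM tE perm_ext_ord.
Qed.

Definition wcoord i a u : Tbar W -> K^o := tlift (wcoord0 i a u).
HB.instance Definition _ i a u :=
  GRing.isLinear.Build K (Tbar W) K^o _ (wcoord i a u)
    (tlift_linear (wcoord0_compat i a u)).

Lemma wcoord_mono i a u s t : size s = p -> wcoord i a u (mono s t) =
  (p`!)%:R^-1 * \sum_(r : 'S_p) (u == (perm_ext r)^-1 * t)%g%:R *
    \prod_k (nth 0 s (r k) : W) (i k) (a k).
Proof. by move=> sp; rewrite /wcoord tlift_mono;
  [rewrite /wcoord0 /= sp eqxx|exact: wcoord0_compat]. Qed.

Lemma mono_expand_word (s : seq W) t : size s = p ->
  mono s t = \sum_(i : {ffun 'I_p -> 'I_n}) \sum_(a : {ffun 'I_p -> 'I_n'})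
    (\prod_(k < p) (nth 0 s k : W) (i k) (a k)) *: mono (word K i a) t.
Proof.
move=> sp; rewrite {1}(famseqP sp).
(* expand over the rows of the matrices first, then over the columns *)
transitivity (mono (famseq (fun k : 'I_p => \sum_(x : 'I_n) 1 *:
  (\sum_(y : 'I_n') (nth 0 s k : W) x y *: wvec K x y))) t).
  congr mono; apply: eq_famseq => k; rewrite {1}[nth 0 s k]matrix_sum_delta.
  by apply: eq_bigr => x _; rewrite scale1r.
rewrite (mono_expand (fun _ _ => 1) (fun (k : 'I_p) x =>
  \sum_(y : 'I_n') (nth 0 s k : W) x y *: wvec K x y)).
apply: eq_bigr => i _; rewrite big1 // scale1r.
exact: (mono_expand (fun (k : 'I_p) y => (nth 0 s k : W) (i k) y) (fun k y =>
  wvec K (i k) y)).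
Qed.

Variable q : nat.
Let Z : finType := ({ffun 'I_p -> 'I_n} * {ffun 'I_p -> 'I_n'} * 'S_(p + q))%type.

(** The monomials in basis vectors are not independent, since S_p permutes them, but
    the averaged coordinates still reconstruct every vector. *)
Lemma mono_frame x : x \in tpq p q ->
  x = \sum_(z : Z) (wcoord z.1.1 z.1.2 (perm_ext z.2) x : K) *:
    mono (word K z.1.1 z.1.2) (perm_ext z.2).
Proof.
pose F x := \sum_(z : Z) (wcoord z.1.1 z.1.2 (perm_ext z.2) x : K) *:
  mono (word K z.1.1 z.1.2) (perm_ext z.2).
have lF : linear F.
  move=> c y y'; rewrite /F scaler_sumr -big_split; apply: eq_bigr => z _ /=.
  by rewrite linearP scalerDl scalerA.
move=> /asboolP[m [c [v [vg ->]]]]; rewrite -/(F _) linear_sumZ //; apply: eq_bigr => k _.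
congr (_ *: _); have [s [t [sp tN ->]]] := vg k.
rewrite /F.
transitivity ((p`!)%:R^-1 *: \sum_(r : 'S_p) mono s t).
  by rewrite sumr_const card_Sn -[mono s t *+ _]scaler_nat scalerA mulVf ?scale1r
    ?fact_neq0.
transitivity ((p`!)%:R^-1 *: \sum_(r : 'S_p) \sum_(w : 'S_(p + q)) (perm_ext w ==
  (perm_ext r)^-1 * t)%g%:R
    *: mono (wact s (perm_ext r)) (perm_ext w)).
  congr (_ *: _); apply: eq_bigr => r _.
  have rN : inS (p + q) ((perm_ext r)^-1 * t)%g.
    by apply: inSM => //; apply/inSV/(inS_le (leq_addr q p))/inS_perm_ext.
  have [w wE] := inS_extP rN.
  rewrite (bigD1 w) //= wE eqxx scale1r big1 ?addr0 => [|w' w'w]; last first.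
    by rewrite (inj_eq (@perm_ext_inj _)) (negPf w'w) scale0r.
  by rewrite -wE mono_bal ?sp; [rewrite mulKVg|apply: inS_perm_ext].
rewrite -(pair_bigA _ (fun (ia : {ffun 'I_p -> 'I_n} * {ffun 'I_p ->
  'I_n'}) (w : 'S_(p + q)) => (wcoord ia.1 ia.2 (perm_ext w) (mono s t) : K) *:
    mono (word K ia.1 ia.2) (perm_ext w))) /=.
rewrite -(pair_bigA _ (fun (i : {ffun 'I_p -> 'I_n}) (a : {ffun 'I_p -> 'I_n'}) =>
  \sum_(w : 'S_(p + q)) (wcoord i a (perm_ext w) (mono s t) : K) *:
    mono (word K i a) (perm_ext w))) /=.
under [RHS]eq_bigr => i _ do (under eq_bigr =>
  a _ do (under eq_bigr do rewrite wcoord_mono // -scalerA scaler_suml;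
    rewrite -scaler_sumr); rewrite -scaler_sumr).
rewrite -scaler_sumr; congr (_ *: _).
transitivity (\sum_(r : 'S_p) \sum_(w : 'S_(p + q)) \sum_(i : {ffun 'I_p ->
  'I_n}) \sum_(a : {ffun 'I_p -> 'I_n'})
   ((perm_ext w == (perm_ext r)^-1 * t)%g%:R *
     \prod_k (nth 0 s (r k) : W) (i k) (a k)) *: mono (word K i a) (perm_ext w)).
  apply: eq_bigr => r _; apply: eq_bigr => w _.
  rewrite mono_expand_word ?size_wact // scaler_sumr; apply: eq_bigr => i _.
  rewrite scaler_sumr; apply: eq_bigr => a _; rewrite scalerA; congr (_ * _ *: _).
  by apply: eq_bigr => l _; rewrite nth_wact ?sp // perm_ext_ord.
rewrite exchange_big /=; under eq_bigr do rewrite exchange_big /=.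
rewrite exchange_big; apply: eq_bigr => i _ /=.
under eq_bigr do rewrite exchange_big /=.
by rewrite exchange_big.
Qed.

Lemma wcoord_nu g i a u x : wcoord i a u (nu g x) =
  \sum_(j : {ffun 'I_p -> 'I_n}) tens_pow g (finfun i) j * wcoord j a u x.
Proof.
move: x; pose G x := \sum_(j : {ffun 'I_p -> 'I_n}) tens_pow g (finfun i) j *
  wcoord j a u x : K^o.
have lG : linear G.
  move=> c y y'; rewrite /G scaler_sumr -big_split; apply: eq_bigr => z _ /=.
  by rewrite linearP mulrDr; congr (_ + _); rewrite mulrCA.
pose L := GRing.isLinear.Build _ _ _ _ G lG.
pose G' : {linear _ -> _} := HB.pack G L.
apply: (@Tbar_ext _ _ _ (wcoord i a u \o nu g) G') => s t /=.
rewrite /G Tmap_mono; have [sp|sp] := eqVneq (size s) p; last first.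
  rewrite /wcoord tlift_mono; last exact: wcoord0_compat.
  rewrite /wcoord0 /= size_map (negPf sp) big1 // => j _.
  by rewrite tlift_mono; [rewrite /wcoord0 /= (negPf sp) mulr0|apply: wcoord0_compat].
under eq_bigr do rewrite wcoord_mono // mulrCA mulr_sumr.
rewrite wcoord_mono ?size_map // -mulr_sumr; congr (_ * _).
rewrite exchange_big; apply: eq_bigr => r _ /=.
under [RHS]eq_bigr do rewrite mulrCA; rewrite -mulr_sumr; congr (_ * _).
under [RHS]eq_bigr do rewrite -big_split /=.
rewrite -(bigA_distr_bigA (fun k y => g (finfun i k) y * (nth 0 s (r k) : W) y (a k))).
by apply: eq_bigr => k _; rewrite (nth_map 0) ?sp // mxE ffunE.
Qed.

End Coordinates.

(** * Q1 and Q2 commute *)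

Lemma lspan_sum (K : fieldType) (M : lmodType K) (A : set M) (I : finType)
    (c : I -> K) (u : I -> M) :
  (forall i, A (u i)) -> lspan A (\sum_i c i *: u i).
Proof.
move=> Au; elim/big_rec: _ => [|i y _ Ay]; first exact: lspan0.
exact: lspanZD (lspan_gen (Au i)) Ay.
Qed.

Lemma fct_sumZE (K : fieldType) (T : Type) (M : lmodType K) (I : finType)
    (c : I -> K) (f : I -> T -> M) x :
  (\sum_i c i *: f i) x = \sum_i c i *: f i x.
Proof. by rewrite fct_sumE. Qed.

Section Commutant.
Variables (K : fieldType) (M : lmodType K).
Implicit Types (A : set (M -> M)) (f g : M -> M).

Lemma linear_sum_fct (I : finType) (c : I -> K) (f : I -> M -> M) :
  (forall i, linear (f i)) -> linear (\sum_i c i *: f i).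
Proof.
move=> lf a x y; rewrite !fct_sumZE scaler_sumr -big_split; apply: eq_bigr => i _ /=.
by rewrite lf scalerDr !scalerA mulrC.
Qed.

Lemma linear_comb_fct a f g : linear f -> linear g -> linear (a *: f + g).
Proof.
move=> lf lg b x y; rewrite -[LHS]/(a *: f (b *: x + y) + g (b *: x + y)).
rewrite -[X in _ = X + _]/(b *: (a *: f x + g x)) -[X in _ = _ + X]/(a *: f y + g y) lf lg.
by rewrite !scalerDr !scalerA (mulrC a) addrACA.
Qed.

(** Reduces commutation with a generated algebra to commutation with generators. *)
Lemma commutant_subalgebra A : (forall f, A f -> linear f) -> op_subalgebra (commutant A).
Proof.
move=> lA; split=> [|a f g [lf fA] [lg gA]|f g [lf fA] [lg gA]].
- by split.
- split=> [|h Ah]; first exact: linear_comb_fct.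
  apply/funext => x; rewrite -[LHS]/(a *: f (h x) + g (h x)).
  rewrite -[RHS]/(h (a *: f x + g x)) (lA _ Ah).
  by congr (_ *: _ + _); [have /(congr1 (@^~ x)) := fA _ Ah|have /(congr1 (@^~ x)) :=
    gA _ Ah].
split=> [b x y|h Ah]; first by rewrite /= lg lf.
by rewrite -compA (gA _ Ah) compA (fA _ Ah).
Qed.

Lemma comp_sumr f (I : finType) (c : I -> K) (u : I -> M -> M) : linear f ->
  f \o (\sum_i c i *: u i) = \sum_i c i *: (f \o u i).
Proof.
move=> lf; apply/funext => x; rewrite /= !fct_sumZE linear_sumZ //.
Qed.

End Commutant.

Section Operators.
Variables (K : fieldType) (n n' p q : nat).
Hypothesis K0 : [pchar K] =i pred0.
Notation W := 'M[K]_(n, n').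
Notation Y := {ffun 'I_p -> 'I_n}.
Notation B := {ffun 'I_p -> 'I_n'}.
Notation N := (p + q)%N.
Notation T := (Tpq W p q).
Notation Z := (Y * B * 'S_N)%type.
Implicit Types (i j : Y) (a b : B) (t u : Sinf) (x y : T).

Definition wmono i a t : T := insubd 0 (mono (word K i a) t).

Lemma wmonoE i a t : inS N t -> val (wmono i a t) = mono (word K i a) t.
Proof. by move=> tN; rewrite val_insubd mono_tpq // size_famseq. Qed.

Lemma wmono_frame x : x = \sum_(z : Z) (wcoord z.1.1 z.1.2 (perm_ext z.2) (val x) : K) *:
  wmono z.1.1 z.1.2 (perm_ext z.2).
Proof.
apply: val_inj; rewrite linear_sum {1}(mono_frame K0 (valP x)); apply: eq_bigr => z _.
by rewrite linearZ /= wmonoE //; apply: inS_perm_ext.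
Qed.

Lemma Tpq_linear_ext (M : lmodType K) (f g : T -> M) : linear f -> linear g ->
  (forall i a (w : 'S_N), f (wmono i a (perm_ext w)) = g (wmono i a (perm_ext w))) -> f = g.
Proof.
move=> lf lg fg; apply/funext => x; rewrite (wmono_frame x) !linear_sumZ //.
by apply: eq_bigr => z _; rewrite fg.
Qed.

Lemma word_permute i a (r : 'S_p) t :
  mono (word K (permute i r) (permute a r)) t = mono (word K i a) (perm_ext r * t)%g.
Proof.
by rewrite -mono_famseq_perm; congr mono; apply: eq_famseq => k; rewrite !ffunE.
Qed.

Lemma nth_word i a (k : 'I_p) : nth 0 (word K i a) k = wvec K (i k) (a k).
Proof. exact: nth_famseq. Qed.

Lemma Lop_word a' b' u i b t : Lop a' b' u (mono (word K i b) t)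
  = \sum_(r : 'S_p) (b' == permute b r)%:R *: mono (word K (permute i r) a') (u *
    (perm_ext r)^-1 * t)%g.
Proof.
rewrite Lop_mono ?size_famseq //; apply: eq_bigr => r _.
case: eqP => [->|b'b].
  rewrite scale1r; congr mono; apply: eq_famseq => k.
  rewrite nth_word !ffunE. apply: mul_delta_mx.
have [k bk] : exists k, b (r k) != b' k.
  apply/existsP; rewrite -negb_forall; apply/forallP => bb.
  by apply: b'b; apply/ffunP => k; rewrite ffunE; apply/esym/eqP/bb.
rewrite scale0r; apply: (@mono_famseq0 _ _ _ _ k).
by rewrite nth_word; apply: mul_delta_mx_0.
Qed.

Lemma Lop_linear a b u : linear (Lop a b u : Tbar W -> Tbar W).
Proof.
move=> c x y; rewrite /Lop scaler_sumr -big_split; apply: eq_bigr => i _ /=.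
have lD : linear (Lwdual i b : Tbar W -> Tbar W).
  by apply: big_comp_linear => k; apply: Ldual_linear.
have lW : linear (Lw i a : Tbar W -> Tbar W).
  by apply: big_comp_linear => k; apply: linearP.
by rewrite lD linearP lW.
Qed.
HB.instance Definition _ a b u :=
  GRing.isLinear.Build K (Tbar W) (Tbar W) _ (Lop a b u) (Lop_linear a b u).

Lemma restr_nu_linear g : linear (restr (nu g) : T -> T).
Proof. by apply: restr_linear; apply: Tmap_tpq. Qed.

Lemma restr_Rperm_linear t : inS N t -> linear (restr (Rperm t) : T -> T).
Proof. by move=> tN; apply: restr_linear; apply: Rperm_tpq. Qed.

Lemma restr_Lop_linear a b t : inS N t -> linear (restr (Lop a b t) : T -> T).
Proof. by move=> tN; apply: restr_linear; apply: Lop_tpq. Qed.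

Lemma Q2P f : Q2 K n n' p q f -> exists (I : finType) (c : I -> K) (a b : I ->
  B) (t : I -> Sinf),
  (forall e, inS N (t e)) /\ f = \sum_e c e *: restr (Lop (a e) (b e) (t e)).
Proof.
move=> [m [c [u [uE ->]]]].
have /choice[h hE] : forall e, exists x : B * B * Sinf, inS N x.2 /\ u e =
  restr (Lop x.1.1 x.1.2 x.2).
  move=> e; have [a [b [t [tN ->]]]] := uE e; exists ([ffun k => a k], [ffun k =>
    b k], t); split=> //=.
  by congr restr; congr Lop; apply/funext => k; rewrite ffunE.
exists 'I_m, c, (fun e => (h e).1.1), (fun e => (h e).1.2), (fun e => (h e).2).
split=> [e|]; first by have [] := hE e.
by apply: eq_bigr => e _; have [_ ->] := hE e.
Qed.

Lemma Q2_linear f : Q2 K n n' p q f -> linear f.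
Proof.
move=> /Q2P[I [c [a [b [t [tN ->]]]]]]; apply: linear_sum_fct => e.
exact: restr_Lop_linear.
Qed.

Lemma map_famseq (h : W -> W) m (v : 'I_m -> W) :
  map h (famseq v) = famseq (fun k => h (v k)).
Proof. by rewrite /famseq -map_comp. Qed.

Lemma size_map_word (g : W -> W) i a : size (map g (word K i a)) = p.
Proof. by rewrite size_map size_famseq. Qed.

Lemma Lop_comm_nu a b t g : inS N t ->
  restr (Lop a b t) \o restr (nu g) = restr (nu g) \o restr (Lop a b t) :> (T -> T).
Proof.
move=> tN; have lL := restr_Lop_linear a b tN; have ln := restr_nu_linear g.
have LT := @Lop_tpq K n n' p q a b t tN; have nT := @Tmap_tpq K W p q (mulmx g).
apply: Tpq_linear_ext => [c x y|c x y|i b' w]; rewrite /= ?ln ?lL ?ln //.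
have wN := inS_perm_ext w.
apply: val_inj; rewrite /= !restrE // wmonoE //.
rewrite /nu Tmap_mono !Lop_mono ?size_map_word ?size_famseq // linear_sum;
  apply: eq_bigr => r _.
rewrite /= Tmap_mono; congr mono; rewrite !map_famseq; apply: eq_famseq => k.
rewrite nth_famseq nth_word; exact: esym (mulmxA _ _ _).
Qed.

Lemma Lop_comm_Rperm a b t u : inS N t -> inS N u ->
  restr (Lop a b t) \o restr (Rperm u) = restr (Rperm u) \o restr (Lop a b t) :> (T -> T).
Proof.
move=> tN uN; have lL := restr_Lop_linear a b tN; have lR := restr_Rperm_linear uN.
have LT := @Lop_tpq K n n' p q a b t tN; have nT := @Rperm_tpq K W p q _ uN.
apply: Tpq_linear_ext => [c x y|c x y|i b' w]; rewrite /= ?lR ?lL ?lR //.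
have wN := inS_perm_ext w.
apply: val_inj; rewrite /= !restrE // wmonoE //.
rewrite Rperm_mono !Lop_mono ?size_famseq // linear_sum; apply: eq_bigr => r _.
by rewrite /= Rperm_mono mulgA.
Qed.

Lemma Q1_sub_commutant : (Q1 K n n' p q `<=` commutant (Q2 K n n' p q))%classic.
Proof.
apply: smallest_sub.
  by apply: commutant_subalgebra; apply: Q2_linear.
move=> _ [[g _ <-]|[u uN <-]].
  split=> [|_ /Q2P[I [c [a [b [t [tN ->]]]]]]]; first exact: restr_nu_linear.
  rewrite comp_sumr; last exact: restr_nu_linear.
  apply/funext => x; rewrite /= !fct_sumZE; apply: eq_bigr => i _; congr (_ *: _).
  by have /(congr1 (@^~ x)) := Lop_comm_nu (a i) (b i) g (tN i).
split=> [|_ /Q2P[I [c [a [b [t [tN ->]]]]]]]; first exact: restr_Rperm_linear.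
rewrite comp_sumr; last exact: restr_Rperm_linear.
apply/funext => x; rewrite /= !fct_sumZE; apply: eq_bigr => i _; congr (_ *: _).
by have /(congr1 (@^~ x)) := Lop_comm_Rperm (a i) (b i) (tN i) uN.
Qed.

Lemma Q1_linear f : Q1 K n n' p q f -> linear f.
Proof. by move=> /Q1_sub_commutant[]. Qed.

Lemma Q2_sub_commutant : (Q2 K n n' p q `<=` commutant (Q1 K n n' p q))%classic.
Proof.
move=> f fQ; split=> [|g /Q1_sub_commutant[_ gQ]]; first exact: Q2_linear.
by rewrite gQ.
Qed.

End Operators.

(** * The commutant of Q1 *)

Section FirstCommutant.
Variables (C : numClosedFieldType) (n n' p q : nat).
Notation W := 'M[C]_(n, n').
Notation Y := {ffun 'I_p -> 'I_n}.
Notation B := {ffun 'I_p -> 'I_n'}.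
Notation N := (p + q)%N.
Notation T := (Tpq W p q).
Implicit Types (i j : Y) (a b : B) (t u : Sinf).

Let C0 : [pchar C] =i pred0 := pchar_num C.

Lemma restr_nu_wmono g i b t : inS N t ->
  restr (nu g) (wmono C q i b t) = \sum_(l : Y) tens_pow g l i *: wmono C q l b t :> T.
Proof.
move=> tN; apply: val_inj; rewrite restrE; last exact: Tmap_tpq.
rewrite linear_sum wmonoE // /nu Tmap_mono map_famseq.
transitivity (mono (famseq (fun k => \sum_(x : 'I_n) g x (i k) *: wvec C x (b k))) t).
  by congr mono; apply: eq_famseq => k; apply: mulmx_wvec.
rewrite (mono_expand (fun k x => g x (i k)) (fun k x => wvec C x (b k))).
by apply: eq_bigr => l _; rewrite linearZ /= wmonoE.
Qed.

Lemma restr_Rperm_wmono i b t u : inS N t -> inS N u ->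
  restr (Rperm u) (wmono C q i b t) = wmono C q i b (t * u)%g :> T.
Proof.
move=> tN uN; apply: val_inj; rewrite restrE; last exact: Rperm_tpq.
by rewrite !wmonoE //; [exact: Rperm_mono|apply: inSM].
Qed.

Lemma wmono_permute i b (r : 'S_p) t : inS N t ->
  wmono C q (permute i r) (permute b r) ((perm_ext r)^-1 * t)%g = wmono C q i b t :> T.
Proof.
move=> tN; have rN : inS N (perm_ext r) by apply: inS_le (leq_addr q p) (inS_perm_ext r).
apply: val_inj; rewrite !wmonoE // ?word_permute ?mulKVg //.
by apply: inSM => //; apply: inSV.
Qed.

(** Commutation with right multiplications reduces f to the monomials with t = 1.
    For fixed w, a and b, the coefficients of f there form a kernel in the
    multi-indices of the first factor that commutes with GL_n, so it is a combination
    of permutations by [schur_weyl].  A permutation of the first factors alone is,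
    by the balancing relation, one of the second factors followed by a left
    multiplication. *)
Lemma commutant_Q1_formula (f : T -> T) : commutant (Q1 C n n' p q) f ->
  exists c : B * B * 'S_N -> 'S_p -> C, forall i b t, inS N t ->
    val (f (wmono C q i b t)) = \sum_(w : 'S_N) \sum_a \sum_(s : 'S_p) c (a, b, w) s *:
      mono (word C i (permute a s)) ((perm_ext s)^-1 * perm_ext w * t)%g.
Proof.
move=> [lf fQ].
have one : inS N (1%g : Sinf) by [].
pose k (x : B * B * 'S_N) (j i : Y) : C :=
  wcoord j x.1.1 (perm_ext x.2) (val (f (wmono C q i x.1.2 1%g))).
have /choice[c cE] : forall x, exists d : 'S_p -> C,
    forall j i, k x j i = \sum_s d s * (i == permute j s)%:R.
  move=> [[a b] w]; apply: schur_weyl => g gU j i.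
  have fn : f \o restr (nu g) = restr (nu g) \o f.
    by apply: fQ; apply: sub_gen_smallest; left; exists g.
  transitivity (wcoord j a (perm_ext w) (val (f (restr (nu g) (wmono C q i b 1%g))))).
    rewrite restr_nu_wmono // linear_sumZ // !linear_sum; apply: eq_bigr => l _.
    by rewrite !linearZ mulrC.
  rewrite -[f (restr _ _)]/((f \o restr (nu g)) _) fn /= restrE; last exact: Tmap_tpq.
  by rewrite wcoord_nu; apply: eq_bigr => l _; rewrite ffunK.
exists c => i b t tN.
have fR : f \o restr (Rperm t) = restr (Rperm t) \o f.
  by apply: fQ; apply: sub_gen_smallest; right; exists t.
have -> : f (wmono C q i b t) = restr (Rperm t) (f (wmono C q i b 1%g)).
  rewrite -[RHS]/((restr (Rperm t) \o f) _) -fR /= restr_Rperm_wmono //.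
  by rewrite mul1g.
rewrite restrE; last exact: Rperm_tpq.
rewrite (mono_frame C0 (valP (f _))) linear_sum /=.
transitivity (\sum_(z : Y * B * 'S_N) \sum_s (c (z.1.2, b, z.2) s *
  (i == permute z.1.1 s)%:R) *:
    mono (word C z.1.1 z.1.2) (perm_ext z.2 * t)%g).
  apply: eq_bigr => z _; rewrite linearZ /= Rperm_mono -scaler_suml; congr (_ *: _).
  exact: (cE (z.1.2, b, z.2)).
rewrite -(pair_bigA _ (fun (z : Y * B) w => \sum_s (c (z.2, b, w) s *
  (i == permute z.1 s)%:R) *:
  mono (word C z.1 z.2) (perm_ext w * t)%g)) /= exchange_big; apply: eq_bigr => w _ /=.
rewrite -(pair_bigA _ (fun (j : Y) (a : B) => \sum_s (c (a, b, w) s *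
  (i == permute j s)%:R) *:
  mono (word C j a) (perm_ext w * t)%g)) /= exchange_big; apply: eq_bigr => a _ /=.
rewrite exchange_big; apply: eq_bigr => s _ /=.
rewrite (bigD1 (permute i s^-1%g)) //= permuteVK eqxx mulr1 big1 ?addr0 => [|j ji];
  last first.
  case: eqP => [ij|_]; last by rewrite mulr0 scale0r.
  by case/eqP: ji; rewrite ij permuteK.
congr (_ *: _); rewrite -{1}(permuteK s a) word_permute perm_extV mulgA.
by [].
Qed.

(** Averaging the previous formula over the p! ways of writing a monomial turns
    its right-hand side into a combination of the operators of Q2. *)
Lemma commutant_Q1_sub : (commutant (Q1 C n n' p q) `<=` Q2 C n n' p q)%classic.
Proof.
move=> f fQ; have [lf _] := fQ; have [c cE] := commutant_Q1_formula fQ.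
(* an index (w, a, b', s) goes with the coefficient c (a, b', w) s *)
pose I : finType := ('S_N * B * B * 'S_p)%type.
pose L (e : I) : T -> T := restr (Lop (permute e.1.1.2 e.2) e.1.2 ((perm_ext e.2)^-1 *
  perm_ext e.1.1.1)%g).
have LN (e : I) : inS N ((perm_ext e.2)^-1 * perm_ext e.1.1.1)%g.
  by apply: inSM (inS_perm_ext _); apply/inSV/(inS_le (leq_addr q p))/inS_perm_ext.
suff -> : f = \sum_(e : I) ((p`!)%:R^-1 * c (e.1.1.2, e.1.2, e.1.1.1) e.2) *: L e.
  apply: lspan_sum => e.
  exists (fun k => permute e.1.1.2 e.2 k), (fun k => e.1.2 k), ((perm_ext e.2)^-1 *
    perm_ext e.1.1.1)%g; split=> //.
apply: (Tpq_linear_ext C0) => // [|i b v].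
  by apply: linear_sum_fct => e; apply: restr_Lop_linear.
have vN := inS_perm_ext v; set t := perm_ext v in vN *.
apply: val_inj; rewrite fct_sumZE linear_sum.
transitivity ((p`!)%:R^-1 *: \sum_(r : 'S_p) val (f (wmono C q i b t))).
  rewrite sumr_const card_Sn -[val _ *+ _]scaler_nat scalerA mulVf ?scale1r //.
  exact: fact_neq0.
transitivity (\sum_(e : I) ((p`!)%:R^-1 * c (e.1.1.2, e.1.2, e.1.1.1) e.2) *:
  \sum_(r : 'S_p) (e.1.2 == permute b r)%:R *:
    mono (word C (permute i r) (permute e.1.1.2 e.2)) ((perm_ext e.2)^-1 *
      perm_ext e.1.1.1 * (perm_ext r)^-1 * t)%g); last first.
  apply: eq_bigr => e _; rewrite linearZ /=; congr (_ *: _).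
  by rewrite restrE ?wmonoE ?Lop_word //; apply: Lop_tpq.
under [RHS]eq_bigr do rewrite -scalerA.
rewrite -scaler_sumr; congr (_ *: _).
under [RHS]eq_bigr do rewrite scaler_sumr.
rewrite exchange_big; apply: eq_bigr => r _ /=.
have rN : inS N ((perm_ext r)^-1 * t)%g.
  by apply: inSM => //; apply/inSV/(inS_le (leq_addr q p))/inS_perm_ext.
rewrite -(wmono_permute i b r vN) cE //.
rewrite -(pair_bigA _ (fun (x : 'S_N * B * B) s => c (x.1.2, x.2, x.1.1) s *:
  ((x.2 == permute b r)%:R *:
   mono (word C (permute i r) (permute x.1.2 s)) ((perm_ext s)^-1 * perm_ext x.1.1 *
     (perm_ext r)^-1 * t)%g))) /=.
rewrite -(pair_bigA _ (fun (x : 'S_N * B) (b' : B) => \sum_s c (x.2, b', x.1) s *: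
  ((b' == permute b r)%:R *:
   mono (word C (permute i r) (permute x.2 s)) ((perm_ext s)^-1 * perm_ext x.1 *
     (perm_ext r)^-1 * t)%g))) /=.
rewrite -(pair_bigA _ (fun (w : 'S_N) (a : B) => \sum_(b' : B) \sum_s c (a, b', w) s *:
  ((b' == permute b r)%:R *:
   mono (word C (permute i r) (permute a s)) ((perm_ext s)^-1 * perm_ext w *
     (perm_ext r)^-1 * t)%g))) /=.
apply: eq_bigr => w _; apply: eq_bigr => a _.
rewrite [RHS](bigD1 (permute b r)) //= [X in _ = _ + X]big1 ?addr0 => [|b' /negPf b'b];
  last first.
  by rewrite big1 // => s _; rewrite b'b scale0r scaler0.
by apply: eq_bigr => s _; rewrite eqxx scale1r !mulgA.
Qed.

End FirstCommutant.

(** * The commutant of Q2 *)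

Section Frame.
Variables (C : numClosedFieldType) (M : lmodType C) (Z : finType).
Variables (bas : Z -> M) (cf : Z -> M -> C^o).
Hypothesis cf_linear : forall z, linear (cf z).
Hypothesis frameE : forall v, v = \sum_z (cf z v : C) *: bas z.

(** As bas is only a frame, [opmx idfun] need not be the identity matrix: it is an
    idempotent, and serves as the unit of the algebra of these matrices. *)
Definition opmx (f : M -> M) : 'M[C]_#|Z| := kmx (fun x y => cf x (f (bas y))).

Lemma opmxM f g : linear f -> opmx (f \o g) = opmx f *m opmx g.
Proof.
move=> lf; rewrite kmxM; congr kmx; apply/funext => x; apply/funext => y /=.
rewrite {1}[g (bas y)]frameE (linear_sumZ _ _ _ lf) (linear_sumZ _ _ _ (cf_linear x)).
by apply: eq_bigr => z _; rewrite regular_scaleE mulrC.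
Qed.

Lemma opmx_comb a f g : opmx (a *: f + g) = a *: opmx f + opmx g.
Proof. by apply/matrixP => i j; rewrite !mxE cf_linear. Qed.

Lemma opmx_inj f g : linear f -> linear g -> opmx f = opmx g -> f = g.
Proof.
move=> lf lg /kmx_inj fg; apply/funext => v; rewrite (frameE v) !linear_sumZ //.
apply: eq_bigr => y _; congr (_ *: _).
rewrite (frameE (f _)) [RHS]frameE; apply: eq_bigr => x _.
by rewrite fg.
Qed.

(** The operators on M realize exactly the compressions of matrices by the unit
    [opmx idfun]. *)
Lemma opmx_surj (b : 'M[C]_#|Z|) : exists f : M -> M,
  linear f /\ opmx f = opmx idfun *m b *m opmx idfun.
Proof.
pose k x y : C := b (enum_rank x) (enum_rank y).
exists (fun v => \sum_x (\sum_y k x y * cf y v) *: bas x); split=> [c v w|].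
  rewrite scaler_sumr -big_split; apply: eq_bigr => x _ /=.
  rewrite scalerA -scalerDl; congr (_ *: _); rewrite mulr_sumr -big_split.
  apply: eq_bigr => y _ /=; rewrite cf_linear regular_scaleE mulrDr mulrCA //.
rewrite (kmxK b) -mulmxA !kmxM; congr kmx; apply/funext => x; apply/funext => y.
rewrite (linear_sumZ _ _ _ (cf_linear x)); apply: eq_bigr => z _.
by rewrite regular_scaleE mulrC.
Qed.

(** The matrix bicommutant theorem carried to operators.  A matrix b commuting with
    the matrices of A is cut down by [opmx_surj] to an operator g commuting with A,
    so that f, which commutes with g, has a matrix commuting with b. *)
Lemma frame_bicommutant (A : set (M -> M)) :
    op_subalgebra A -> (forall f, A f -> linear f) ->
    (forall f, A f -> exists2 f', A f' & opmx f' = (opmx f)^H) ->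
  (commutant (commutant A) `<=` A)%classic.
Proof.
move=> [A1 AZD AM] lA AJ f [lf fA].
pose e := opmx idfun.
have l1 : linear (idfun : M -> M) by [].
have mul1e g : e *m opmx g = opmx g by rewrite -(@opmxM idfun g).
have mule1 g : linear g -> opmx g *m e = opmx g by move=> lg; rewrite -(@opmxM g idfun).
suff [h Ah fh] : exists2 h, A h & opmx f = opmx h.
  by rewrite (opmx_inj lf (lA _ Ah) fh).
apply: (@star_algebra_bicommutant _ _ (fun m => exists2 h, A h & m = opmx h) e).
- move=> c _ _ [g Ag ->] [h Ah ->]; exists (c *: g + h); first exact: AZD.
  by rewrite opmx_comb.
- move=> _ _ [g Ag ->] [h Ah ->]; exists (g \o h); first exact: AM.
  by rewrite (@opmxM g h) //; exact: lA Ag.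
- by move=> _ [g Ag ->]; have [g' Ag' <-] := AJ g Ag; exists g'.
- by exists idfun.
- exact: mule1.
move=> b bA; have [g [lg gE]] := opmx_surj b.
have eb : e *m b = b *m e by apply: bA; exists idfun.
have ee : e *m e = e by apply: mul1e.
have gE1 : opmx g = e *m b by rewrite gE -/e -mulmxA -eb mulmxA ee.
have gA : commutant A g.
  split=> // h Ah; have lh := lA _ Ah.
  apply: opmx_inj => [c x y|c x y|]; rewrite /= ?lh ?lg ?lh //.
  rewrite (@opmxM g h) // (@opmxM h g) // gE1 -mulmxA -bA; last by exists h.
  by rewrite !mulmxA mul1e mule1.
have fg := congr1 opmx (fA _ gA).
rewrite (@opmxM f g) // (@opmxM g f) // gE1 in fg.
rewrite -{1}(mule1 f lf) -mulmxA fg.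
by rewrite eb -mulmxA mul1e.
Qed.

End Frame.

Section SecondCommutant.
Variables (C : numClosedFieldType) (n n' p q : nat).
Notation W := 'M[C]_(n, n').
Notation Y := {ffun 'I_p -> 'I_n}.
Notation B := {ffun 'I_p -> 'I_n'}.
Notation N := (p + q)%N.
Notation T := (Tpq W p q).
Notation Z := (Y * B * 'S_N)%type.
Implicit Types (i j : Y) (a b : B) (t u : Sinf).

Let C0 : [pchar C] =i pred0 := pchar_num C.

(** Exchanging the two monomials replaces the permutation r in the average by its
    inverse. *)
Lemma wcoord_word_herm i a u j b t :
  wcoord i a u (mono (word C j b) t) = (wcoord j b t (mono (word C i a) u))^*.
Proof.
rewrite !wcoord_mono ?size_famseq // rmorphM fmorphV rmorph_nat rmorph_sum; congr (_ * _).
rewrite (reindex_inj invg_inj); apply: eq_bigr => r _ /=.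
rewrite rmorphM rmorph_nat rmorph_prod; congr ((nat_of_bool _)%:R * _).
  by rewrite perm_extV invgK; apply/eqP/eqP => ->; rewrite ?mulKg ?mulKVg.
rewrite (reindex_inj (@perm_inj _ r)); apply: eq_bigr => k _ /=.
by rewrite permK !nth_word !mxE rmorph_nat ![_ == i _]eq_sym ![_ == a _]eq_sym.
Qed.

Lemma wcoord_word_shift i a u j b t v :
  wcoord i a u (mono (word C j b) (t * v)%g) = wcoord i a (u *
    v^-1)%g (mono (word C j b) t).
Proof.
rewrite !wcoord_mono ?size_famseq //; congr (_ * _); apply: eq_bigr => r _;
  congr ((nat_of_bool _)%:R * _).
by rewrite mulgA (can2_eq (mulgKV v) (mulgK v)).
Qed.

Let bas (z : Z) : T := wmono C q z.1.1 z.1.2 (perm_ext z.2).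
Let cf (z : Z) (v : T) : C^o := wcoord z.1.1 z.1.2 (perm_ext z.2) (val v).

Lemma restr_nu_adjoint g : opmx bas cf (restr (nu g^H)) = (opmx bas cf (restr (nu g)))^H.
Proof.
apply/matrixP => y x; rewrite !mxE; move: (enum_val x) (enum_val y) => {}x {}y.
have xN := inS_perm_ext x.2; have yN := inS_perm_ext y.2.
rewrite /bas /cf restr_nu_wmono // !linear_sum restrE; last exact: Tmap_tpq.
rewrite wcoord_nu rmorph_sum; apply: eq_bigr => l _.
rewrite !linearZ rmorphM /= !wmonoE // -wcoord_word_herm ffunK; congr (_ * _).
by rewrite /tens_pow rmorph_prod; apply: eq_bigr => k _; rewrite !mxE.
Qed.

Lemma restr_Rperm_adjoint t : inS N t ->
  opmx bas cf (restr (Rperm t^-1%g)) = (opmx bas cf (restr (Rperm t)))^H.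
Proof.
move=> tN; have tVN := inSV tN.
apply/matrixP => y x; rewrite !mxE; move: (enum_val x) (enum_val y) => {}x {}y.
have xN := inS_perm_ext x.2; have yN := inS_perm_ext y.2.
rewrite /bas /cf !restr_Rperm_wmono // (wmonoE _ _ _ (inSM xN tVN)) (wmonoE _ _ _ (inSM
  yN tN)).
by rewrite -wcoord_word_herm wcoord_word_shift invgK.
Qed.

Lemma Q1_subalgebra : op_subalgebra (Q1 C n n' p q).
Proof.
split=> [A [[]]//|c f g Af Ag A AS|f g Af Ag A AS]; have [[_ AZD AM] _] := AS.
  by apply: AZD; [apply: Af|apply: Ag].
by apply: AM; [apply: Af|apply: Ag].
Qed.

(** Stability of Q1 under adjoints only needs to be seen on the generators, where
    it comes from that of GL_n under conjugate transposition and that of S_(p+q)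
    under inversion. *)
Lemma Q1_adjoint f : Q1 C n n' p q f ->
  exists2 f', Q1 C n n' p q f' & opmx bas cf f' = (opmx bas cf f)^H.
Proof.
have cf_linear z : linear (cf z) by move=> c v w; rewrite /cf !linearP.
have [Q11 QZD QM] := Q1_subalgebra.
suff : (Q1 C n n' p q `<=` [set f | Q1 C n n' p q f /\
    exists2 f', Q1 C n n' p q f' & opmx bas cf f' = (opmx bas cf f)^H])%classic.
  by move=> QS /QS[].
apply: smallest_sub => [|_ [[g gU <-]|[t tN <-]]].
- split=> [|c f1 f2 [Qf1 [g1 Qg1 g1E]] [Qf2 [g2 Qg2 g2E]]|f1 f2 [Qf1 [g1 Qg1 g1E]] [Qf2
    [g2 Qg2 g2E]]].
  + split=> //; exists idfun => //; apply/matrixP => y x; rewrite !mxE /bas /cf /=.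
    by rewrite !(wmonoE _ _ _ (inS_perm_ext _)); apply: wcoord_word_herm.
  + split; first exact: QZD.
    exists (c^* *: g1 + g2); first exact: QZD.
    rewrite !(opmx_comb _ cf_linear) g1E g2E; apply/matrixP => i j.
    by rewrite !mxE rmorphD rmorphM.
  split; first exact: QM.
  exists (g2 \o g1); first exact: QM.
  have oM := opmxM cf_linear (wmono_frame C0 : forall v, v = \sum_z (cf z v : C) *: bas z).
  rewrite (oM g2 g1 (Q1_linear C0 Qg2)) (oM f1 f2 (Q1_linear C0 Qf1)).
  by rewrite g1E g2E map_mxM trmx_mul.
- split; first by apply: sub_gen_smallest; left; exists g.
  exists (restr (nu g^H)); last exact: restr_nu_adjoint.
  apply: sub_gen_smallest; left; exists g^H => //=.
  by rewrite unitmx_tr map_unitmx.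
split; first by apply: sub_gen_smallest; right; exists t.
exists (restr (Rperm t^-1%g)); last exact: restr_Rperm_adjoint.
by apply: sub_gen_smallest; right; exists t^-1%g => //; apply: inSV.
Qed.

(** Since Q2 is the commutant of Q1, this is the bicommutant theorem for Q1. *)
Lemma commutant_Q2_sub : (commutant (Q2 C n n' p q) `<=` Q1 C n n' p q)%classic.
Proof.
have -> : Q2 C n n' p q = commutant (Q1 C n n' p q).
  by apply/seteqP; split; [apply: (Q2_sub_commutant C0)|apply: commutant_Q1_sub].
apply: (@frame_bicommutant _ _ _ bas cf).
- by move=> z c v w; rewrite /cf !linearP.
- exact: (wmono_frame C0).
- exact: Q1_subalgebra.
- exact: (Q1_linear C0).
- exact: Q1_adjoint.
Qed.
End SecondCommutant.

Theorem theorem3p7 (R : realType) (n n' p q : nat)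
    (hn : (0 < n)%N) (hn' : (0 < n')%N) :
  Q2 R[i] n n' p q = commutant (Q1 R[i] n n' p q) /\
  Q1 R[i] n n' p q = commutant (Q2 R[i] n n' p q).
Proof.
have C0 := pchar_num R[i]; split; apply/seteqP; split.
- exact: Q2_sub_commutant.
- exact: commutant_Q1_sub.
- exact: Q1_sub_commutant.
- exact: commutant_Q2_sub.
Qed.
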